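(* Let $p,q\geq 2$ be coprime integers. Then there exists $\delta=\delta(p,q)>0$ such that for every $(p,q)$-periodic $V:\mathbb{Z}^2\to\mathbb{R}$ with $\|V\|_\infty\leq\delta$, the spectrum $\sigma(\Delta+V)$ is an interval.
   Context: A function $V:\mathbb{Z}^2\to\mathbb{R}$ is $(p,q)$-periodic if $V(n_1+p,n_2)=V(n_1,n_2)=V(n_1,n_2+q)$ for all $(n_1,n_2)\in\mathbb{Z}^2$. The discrete Laplacian on $\ell^2(\mathbb{Z}^2)$ is $\Delta u(n)=\sum_{j=1}^{2}\big(u(n-b_j)+u(n+b_j)\big)$, with $b_1,b_2$ the standard basis of $\mathbb{Z}^2$; $\Delta+V$ acts on $\ell^2(\mathbb{Z}^2)$, with $V$ acting by multiplication. $\|V\|_\infty=\sup_n|V(n)|$. *)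

(* Defs.v *)
From mathcomp Require Import all_boot all_order all_algebra.
From mathcomp Require Import all_classical all_reals all_analysis.
From mathcomp Require Import complex ring lra.

Set Implicit Arguments.
Unset Strict Implicit.
Unset Printing Implicit Defensive.

Import Order.TTheory GRing.Theory Num.Theory.

Local Open Scope classical_set_scope.
Local Open Scope complex_scope.
Local Open Scope ring_scope.

Definition lattice : Type := (int * int)%type.

Definition pq_periodic (R : realType) (p q : nat) (V : lattice -> R) : Prop :=
  forall n1 n2 : int,
    V (n1 + p%:Z, n2) = V (n1, n2) /\ V (n1, n2) = V (n1, n2 + q%:Z).

(* Extended-real valued, so that an unbounded V gets norm +oo. *)
Definition supnorm (R : realType) (V : lattice -> R) : \bar R :=
  ereal_sup [set `|V n|%:E | n in [set: lattice]].

(* The squared l^2 norm of an arbitrary lattice function, possibly +oo. *)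
Definition l2sq (R : realType) (u : lattice -> R[i]) : \bar R :=
  (\esum_(n in [set: lattice]) (Normc.normc (u n) ^+ 2)%:E)%E.

Definition l2 (R : realType) : set (lattice -> R[i]) :=
  [set u | (l2sq u < +oo)%E].

Definition l2norm (R : realType) (u : lattice -> R[i]) : R :=
  Num.sqrt (fine (l2sq u)).

(* A bounded linear operator on l^2(Z^2) is encoded as a map on all lattice
   functions; only its restriction to [@l2 R] is meaningful. *)
Definition bounded_operator (R : realType)
    (T : (lattice -> R[i]) -> (lattice -> R[i])) : Prop :=
  [/\ forall u, l2 u -> l2 (T u),
      forall (a : R[i]) u v, l2 u -> l2 v ->
        T (fun n => a * u n + v n) = (fun n => a * T u n + T v n)
    & exists M : R, forall u, l2 u -> l2norm (T u) <= M * l2norm u].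

Definition spectrum (R : realType)
    (T : (lattice -> R[i]) -> (lattice -> R[i])) : set R[i] :=
  [set z | ~ exists S : (lattice -> R[i]) -> (lattice -> R[i]),
     bounded_operator S /\
     forall u, l2 u -> S (fun n => T u n - z * u n) = u /\
                       (fun n => T (S u) n - z * S u n) = u].

Definition laplacian (R : realType) (u : lattice -> R[i]) : lattice -> R[i] :=
  fun n => u (n - (1, 0)) + u (n + (1, 0)) + (u (n - (0, 1)) + u (n + (0, 1))).

Definition schrodinger (R : realType) (V : lattice -> R) (u : lattice -> R[i]) :
  lattice -> R[i] := fun n => laplacian u n + (V n)%:C * u n.

Section SchrodingerBounded.
Variable R : realType.
Implicit Types (u v : lattice -> R[i]) (V : lattice -> R).

Lemma normc2E (z : R[i]) :
  Normc.normc z ^+ 2 = complex.Re z ^+ 2 + complex.Im z ^+ 2.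
Proof. by case: z => a b /=; rewrite sqr_sqrtr// addr_ge0// sqr_ge0. Qed.

Lemma normc2D (z w : R[i]) : Normc.normc (z + w) ^+ 2 <=
  (Normc.normc z ^+ 2 + Normc.normc w ^+ 2)
  + (Normc.normc z ^+ 2 + Normc.normc w ^+ 2).
Proof.
rewrite !normc2E; case: z w => [a b] [c d] /=.
have := sqr_ge0 (a - c); have := sqr_ge0 (b - d); nra.
Qed.

Lemma l2sq_ge0 u : (0 <= l2sq u)%E.
Proof. by apply: esum_ge0 => n _; rewrite lee_fin sqr_ge0. Qed.

Lemma l2sqD u v :
  (l2sq (u + v)%R <= (l2sq u + l2sq v) + (l2sq u + l2sq v))%E.
Proof.
have N0 w : forall n : lattice, [set: lattice] n ->
    (0 <= (Normc.normc (w n) ^+ 2)%:E :> \bar R)%E.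
  by move=> n _; rewrite lee_fin sqr_ge0.
have NN n : [set: lattice] n -> (0 <= (Normc.normc (u n) ^+ 2)%:E +
    (Normc.normc (v n) ^+ 2)%:E :> \bar R)%E.
  by move=> _; apply: adde_ge0; exact: N0.
rewrite /l2sq -(esumD (N0 u) (N0 v)) -(esumD NN NN).
apply: le_esum => n _; rewrite -!EFinD lee_fin; exact: normc2D.
Qed.

Lemma l2sq_shift u (a : lattice) : l2sq (fun n => u (n + a)) = l2sq u.
Proof.
rewrite /l2sq [RHS](@reindex_esum _ _ _ [set: lattice] [set: lattice]
  (fun n : lattice => n + a) (fun n => (Normc.normc (u n) ^+ 2)%:E)) //.
  split=> //; first by move=> x y _ _; exact: addIr.
  by move=> x _; exists (x - a) => //; rewrite subrK.
Qed.

Lemma esum_le_scale (c : R) (a b : lattice -> \bar R) : 0 <= c ->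
  (forall n, 0 <= a n)%E -> (forall n, b n <= c%:E * a n)%E ->
  (\esum_(n in [set: lattice]) b n <=
   c%:E * \esum_(n in [set: lattice]) a n)%E.
Proof.
move=> c0 a0 ba; apply: ge_ereal_sup => _ [A [finA _] <-].
apply: (@le_trans _ _ (\sum_(n \in A) (c%:E * a n))%E).
  by apply: lee_fsum => // n _; exact: ba.
rewrite -ge0_mule_fsumr //; apply: lee_wpmul2l; rewrite ?lee_fin//.
by apply: ereal_sup_ubound; exists A.
Qed.

Lemma l2sq_mul V (M : R) u : (forall n, `|V n| <= M) ->
  (l2sq (fun n => ((V n)%:C * u n)%R) <= (M ^+ 2)%:E * l2sq u)%E.
Proof.
move=> VM; apply: esum_le_scale; first exact: sqr_ge0.
  by move=> n; rewrite lee_fin sqr_ge0.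
move=> n; rewrite -EFinM lee_fin Normc.normcM exprMn ler_wpM2r ?sqr_ge0//.
rewrite normc2E /= expr0n addr0 -(real_normK (num_real (V n))).
by rewrite ler_sqr ?nnegrE// (le_trans (normr_ge0 _) (VM n)).
Qed.

Lemma schrodinger_bounded V : (supnorm V < +oo)%E ->
  bounded_operator (schrodinger V).
Proof.
move=> Voo.
have sV n : (`|V n|%:E <= supnorm V)%E by apply: ereal_sup_ubound; exists n.
have Vfin : supnorm V \is a fin_num.
  rewrite ge0_fin_numE//; exact: le_trans (sV (0, 0)).
have VM n : `|V n| <= fine (supnorm V) by rewrite -lee_fin fineK.
set M := fine (supnorm V) in VM.
pose C : R := 32 + 2 * M ^+ 2.
have C0 : 0 <= C by rewrite addr_ge0// mulr_ge0// sqr_ge0.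
have key u : l2 u -> (l2sq (schrodinger V u) <= C%:E * l2sq u)%E.
  move=> u2; have ufin : l2sq u \is a fin_num by rewrite ge0_fin_numE ?l2sq_ge0.
  pose U (a : lattice) n := u (n + a).
  have -> : schrodinger V u = (U (- (1, 0)) + U (1, 0) +
      (U (- (0, 1)) + U (0, 1))) + (fun n => (V n)%:C * u n) by [].
  have D v w (c d : R) : (l2sq v <= c%:E * l2sq u)%E ->
      (l2sq w <= d%:E * l2sq u)%E ->
      (l2sq (v + w)%R <= (2 * (c + d))%:E * l2sq u)%E.
    move=> vc wd; apply: (le_trans (l2sqD v w)).
    have : (l2sq v + l2sq w <= (c + d)%:E * l2sq u)%E.
      by rewrite EFinD -(fineK ufin) muleDl// leeD// fineK.
    move=> H; apply: (le_trans (leeD H H)).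
    by rewrite -(fineK ufin) -!EFinM -EFinD lee_fin; lra.
  have S a : (l2sq (U a) <= 1%:E * l2sq u)%E by rewrite l2sq_shift mul1e.
  have := D _ _ _ _ (D _ _ _ _ (D _ _ _ _ (S (- (1, 0))) (S (1, 0)))
    (D _ _ _ _ (S (- (0, 1))) (S (0, 1)))) (l2sq_mul u VM).
  by move=> /le_trans; apply; rewrite -(fineK ufin) -!EFinM lee_fin
    ler_wpM2r ?fine_ge0 ?l2sq_ge0// /C; lra.
split.
- move=> u u2; apply: (le_lt_trans (key u u2)).
  have ufin : l2sq u \is a fin_num by rewrite ge0_fin_numE ?l2sq_ge0.
  by rewrite -(fineK ufin) -EFinM ltry.
- by move=> a u v _ _; apply/funext => n;
    rewrite /schrodinger /laplacian; ring.
- exists (Num.sqrt C) => u u2.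
  have ufin : l2sq u \is a fin_num by rewrite ge0_fin_numE ?l2sq_ge0.
  rewrite /l2norm -sqrtrM//; apply: ler_wsqrtr.
  have -> : C * fine (l2sq u) = fine (C%:E * l2sq u)%E.
    by rewrite -(fineK ufin) -EFinM.
  have H := key u u2; apply: fine_le => //.
    rewrite ge0_fin_numE ?l2sq_ge0//; apply: (le_lt_trans H).
    by rewrite -(fineK ufin) -EFinM ltry.
  by rewrite -(fineK ufin) -EFinM.
Qed.

End SchrodingerBounded.

(* Main.v *)
(* Floquet theory turns [T = Delta + V] into Hermitian matrices [floquet s t],
   which for small [V] are perturbations of diagonal matrices with entries
   [2 cos (s + 2 pi j / p) + 2 cos (t + 2 pi k / q)].
   Inside (-4, 4): a generic point of the level curve [2 cos x + 2 cos y = E]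
   has none of its nontrivial translates on the curve, since such coincidences
   are roots of a quartic in [cos x], nonzero because [p] and [q] are coprime.
   So the free determinant changes sign there; by the intermediate value theorem
   so does the perturbed one, and compactness makes this uniform in [E].
   Near the upper edge: if [E] is in the resolvent set, the matrices
   [E - floquet s 0] are uniformly bounded below, hence their positivity
   propagates from [s = pi / p] to [s = 0]. Solving [(E - T) phi = 1] among
   periodic functions then gives a positive supersolution, so [T <= E] and there
   is no spectrum above [E]. The lower edge follows by conjugation with
   [(-1)^(n1 + n2)], which maps [T] to [- (Delta - V)]. *)

Require Import Defs.
From mathcomp Require Import all_boot all_order all_algebra.
From mathcomp Require Import all_classical all_reals all_analysis.
From mathcomp Require Import complex perm ring lra zify.

Set Implicit Arguments.
Unset Strict Implicit.
Unset Printing Implicit Defensive.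

Import Order.TTheory GRing.Theory Num.Theory.
Import numFieldNormedType.Exports.

Local Open Scope classical_set_scope.
Local Open Scope complex_scope.
Local Open Scope ring_scope.

(** * Signed sums over the lattice *)

(** Membership in the spectrum is read throughout as the failure of a lower bound: [T - z] is
    invertible as soon as it and [T - z^*] are bounded below, and conversely a resolvent yields such
    a bound. Floquet theory is then needed in one direction only, from the operator to the matrices:
    a lower bound for [T - E] passes to all [floquet s t - E] with one constant, by testing on
    slowly decaying truncations of Bloch waves. So neither a direct integral nor an enumeration of
    band functions appears. Two regimes are forced. As $E\to\pm 4$ the level curve of the free
    symbol shrinks to a point, so the determinant argument gives no threshold that is uniform up to
    the edges. The edge argument covers the energies beyond $4-e$, where [e] comes from a spectral
    gap of the free matrices at [s = pi / p]: there the first Bloch factor has [p]-th power $-1$ and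
    stays away from 1. With [e] fixed, the determinant argument is asked for on a compact middle
    segment only. *)

Section LatticeSum.
Variable R : realType.
Implicit Types (f g h : lattice -> R) (u v : lattice -> R[i]).

Definition lsummable f : Prop :=
  (\esum_(n in [set: lattice]) `|f n|%:E < +oo)%E.

(* Both series have nonnegative terms, so no order of summation is involved. *)
Definition lsum f : R :=
  fine (\esum_(n in [set: lattice]) (`|f n| + f n)%:E)%E -
  fine (\esum_(n in [set: lattice]) `|f n|%:E)%E.

Lemma lsummable_le f g : (forall n, `|f n| <= g n) -> lsummable g -> lsummable f.
Proof.
move=> fg; apply: le_lt_trans; apply: le_esum => n _.
by rewrite lee_fin (le_trans (fg n)) ?ler_norm.
Qed.

Lemma eq_lsummable f g : f =1 g -> lsummable f -> lsummable g.
Proof. by move=> /funext ->. Qed.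

Lemma eq_lsum f g : f =1 g -> lsum f = lsum g.
Proof. by move=> /funext ->. Qed.

Lemma lsummable_norm f : lsummable f -> lsummable (fun n => `|f n|).
Proof. by apply: le_lt_trans; apply: le_esum => n _; rewrite normr_id. Qed.

Lemma lsummableD f g : lsummable f -> lsummable g ->
  lsummable (fun n => f n + g n).
Proof.
move=> lf lg; apply: le_lt_trans (lte_add_pinfty lf lg).
rewrite -esumD; try by move=> n _; rewrite lee_fin.
by apply: le_esum => n _; rewrite -EFinD lee_fin ler_normD.
Qed.

Lemma lsummableZ a f : lsummable f -> lsummable (fun n => a * f n).
Proof.
move=> lf.
have : (\esum_(n in [set: lattice]) `|a * f n|%:E <=
        `|a|%:E * \esum_(n in [set: lattice]) `|f n|%:E)%E.
  apply: esum_le_scale => [//|n|n]; first by rewrite lee_fin.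
  by rewrite normrM EFinM.
move/le_lt_trans; apply.
rewrite ltey_eq; apply/orP; left; rewrite fin_numM// ge0_fin_numE//.
by apply: esum_ge0 => n _; rewrite lee_fin.
Qed.

Lemma lsummableN f : lsummable f -> lsummable (fun n => - f n).
Proof.
by move=> /(lsummableZ (-1)); apply: eq_lsummable => n; rewrite mulN1r.
Qed.

Lemma lsummableB f g : lsummable f -> lsummable g ->
  lsummable (fun n => f n - g n).
Proof. by move=> lf lg; apply: lsummableD => //; exact: lsummableN. Qed.

Lemma lsummable0 : lsummable (fun=> 0).
Proof. by rewrite /lsummable esum1// => n _; rewrite normr0. Qed.

Lemma lsummable_sum (I : Type) (r : seq I) (F : I -> lattice -> R) :
  (forall i, lsummable (F i)) -> lsummable (fun n => \sum_(i <- r) F i n).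
Proof.
move=> lF; elim: r => [|i r IH].
  by apply: eq_lsummable lsummable0 => n; rewrite big_nil.
apply: eq_lsummable (lsummableD (lF i) IH) => n.
by rewrite big_cons.
Qed.

Let fin_esum f : (forall n, 0 <= f n) -> lsummable f ->
  (\esum_(n in [set: lattice]) (f n)%:E)%E \is a fin_num.
Proof.
move=> f0 lf; rewrite ge0_fin_numE; last first.
  by apply: esum_ge0 => n _; rewrite lee_fin.
apply: le_lt_trans lf; apply: le_esum => n _.
by rewrite lee_fin ler_norm.
Qed.

Let absD_ge0 (x : R) : 0 <= `|x| + x.
Proof. by have := ler_norm (- x); rewrite normrN; lra. Qed.

(** Cross-adding the two decompositions of [f] gives an identity between nonnegative families, where
    [esumD] applies. Linearity of [lsum] reduces to this freedom of decomposition. *)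
Let lsumE f g h : (forall n, 0 <= g n) -> (forall n, 0 <= h n) ->
  lsummable g -> lsummable h -> (forall n, f n = g n - h n) ->
  lsum f = fine (\esum_(n in [set: lattice]) (g n)%:E)%E -
           fine (\esum_(n in [set: lattice]) (h n)%:E)%E.
Proof.
move=> g0 h0 lg lh fE.
have lf : lsummable f.
  by rewrite (_ : f = fun n => g n - h n); [exact: lsummableB|exact/funext].
have la := lsummable_norm lf; have ls := lsummableD la lf.
apply/eqP; rewrite /lsum subr_eq addrAC eq_sym subr_eq eq_sym; apply/eqP.
rewrite -!fineD ?fin_esum//; congr fine.
rewrite -!esumD; try by move=> n _; rewrite lee_fin.
by apply: eq_esum => n _; rewrite -!EFinD fE; congr EFin; ring.
Qed.

Lemma lsum_ge0E f : (forall n, 0 <= f n) -> lsummable f ->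
  (lsum f)%:E = (\esum_(n in [set: lattice]) (f n)%:E)%E.
Proof.
move=> f0 lf.
rewrite (@lsumE f f (fun=> 0))//; last first.
- by move=> n; rewrite subr0.
- exact: lsummable0.
by rewrite [X in _ - fine X]esum1// subr0 fineK ?fin_esum.
Qed.

Lemma lsum_ge0 f : (forall n, 0 <= f n) -> lsummable f -> 0 <= lsum f.
Proof.
move=> f0 lf; rewrite -lee_fin lsum_ge0E//.
by apply: esum_ge0 => n _; rewrite lee_fin.
Qed.

Lemma lsumD f g : lsummable f -> lsummable g ->
  lsum (fun n => f n + g n) = lsum f + lsum g.
Proof.
move=> lf lg.
have la := lsummable_norm lf; have ls := lsummableD la lf.
have lb := lsummable_norm lg; have lt := lsummableD lb lg.
rewrite (@lsumE _ (fun n => (`|f n| + f n) + (`|g n| + g n))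
  (fun n => `|f n| + `|g n|)); first last.
- by move=> n; ring.
- exact: lsummableD.
- exact: lsummableD.
- by move=> n; rewrite addr_ge0.
- by move=> n; rewrite addr_ge0.
under eq_esum do rewrite EFinD.
under [X in _ - fine X]eq_esum do rewrite EFinD.
rewrite !esumD; try by move=> n _; rewrite lee_fin.
by rewrite !fineD ?fin_esum// /lsum; ring.
Qed.

Lemma lsumN f : lsummable f -> lsum (fun n => - f n) = - lsum f.
Proof.
move=> lf.
have la := lsummable_norm lf; have ls := lsummableD la lf.
rewrite (@lsumE _ (fun n => `|f n|) (fun n => `|f n| + f n))//; last first.
  by move=> n; ring.
by rewrite /lsum opprB.
Qed.

Lemma lsumB f g : lsummable f -> lsummable g ->
  lsum (fun n => f n - g n) = lsum f - lsum g.
Proof. by move=> lf lg; rewrite lsumD ?lsumN//; exact: lsummableN. Qed.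

Lemma le_lsum f g : lsummable f -> lsummable g -> (forall n, f n <= g n) ->
  lsum f <= lsum g.
Proof.
move=> lf lg fg; rewrite -subr_ge0 -lsumB//; apply: lsum_ge0.
  by move=> n; rewrite subr_ge0.
exact: lsummableB.
Qed.

Let esum_shift (F : lattice -> \bar R) (a : lattice) :
  (\esum_(n in [set: lattice]) F (n + a)%R = \esum_(n in [set: lattice]) F n)%E.
Proof.
rewrite [RHS](@reindex_esum _ _ _ [set: lattice] [set: lattice]
  (fun n : lattice => n + a) F)//.
split=> //; first by move=> x y _ _; exact: addIr.
by move=> x _; exists (x - a) => //; rewrite subrK.
Qed.

Lemma lsummable_shift f a : lsummable f -> lsummable (fun n => f (n + a)).
Proof. by rewrite /lsummable (esum_shift (fun n => `|f n|%:E)%E). Qed.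

Lemma lsum_shift f a : lsum (fun n => f (n + a)) = lsum f.
Proof.
rewrite /lsum (esum_shift (fun n => `|f n|%:E)%E).
by rewrite (esum_shift (fun n => (`|f n| + f n)%:E)%E).
Qed.

(** One inequality is [esum_le_scale]; the other is the same inequality for $a^{-1}$, applied to $a
    f$. *)
Let lsumZ0 a f : 0 < a -> (forall n, 0 <= f n) -> lsummable f ->
  lsum (fun n => a * f n) = a * lsum f.
Proof.
move=> a0 f0 lf.
have le b g : 0 < b -> (forall n, 0 <= g n) -> lsummable g ->
    lsum (fun n => b * g n) <= b * lsum g.
  move=> b0 g0 lg; rewrite -lee_fin EFinM !lsum_ge0E//.
  - apply: esum_le_scale => [|n|n]; first exact: ltW.
      by rewrite lee_fin.
    by rewrite EFinM.
  - by move=> n; rewrite mulr_ge0// ltW.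
  - exact: lsummableZ.
apply/eqP; rewrite eq_le le//=.
rewrite -ler_pdivlMl//; apply: le_trans (le a^-1 _ _ _ _).
- by rewrite (eq_lsum (g := f))// => n; rewrite mulKf ?gt_eqF.
- by rewrite invr_gt0.
- by move=> n; rewrite mulr_ge0// ltW.
- exact: lsummableZ.
Qed.

Lemma lsumZ a f : lsummable f -> lsum (fun n => a * f n) = a * lsum f.
Proof.
move=> lf.
have pos b : 0 < b -> lsum (fun n => b * f n) = b * lsum f.
  move=> b0.
  have la := lsummable_norm lf; have ls := lsummableD la lf.
  transitivity (lsum (fun n => b * (`|f n| + f n) - b * `|f n|)).
    by apply: eq_lsum => n; ring.
  rewrite lsumB ?lsumZ0//; try exact: lsummableZ.
  by rewrite lsumD//; ring.
have [a0|a0|->] := ltgtP a 0; last 2 first.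
- exact: pos.
- transitivity (lsum (fun n => f n - f n)).
    by apply: eq_lsum => n; ring.
  by rewrite lsumB//; ring.
transitivity (lsum (fun n => - (- a * f n))).
  by apply: eq_lsum => n; ring.
rewrite lsumN; last exact: lsummableZ.
by rewrite pos ?oppr_gt0//; ring.
Qed.

Lemma lsum0 : lsum (fun=> 0) = 0.
Proof.
transitivity (lsum (fun=> 0 - 0)); first by apply: eq_lsum => n; rewrite subr0.
by rewrite lsumB ?subrr//; exact: lsummable0.
Qed.

Lemma lsum_sum (I : Type) (r : seq I) (F : I -> lattice -> R) :
  (forall i, lsummable (F i)) ->
  lsum (fun n => \sum_(i <- r) F i n) = \sum_(i <- r) lsum (F i).
Proof.
move=> lF; elim: r => [|i r IH].
  rewrite big_nil; transitivity (lsum (fun=> 0)); last exact: lsum0.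
  by apply: eq_lsum => n; rewrite big_nil.
rewrite big_cons -IH -lsumD//; last exact: lsummable_sum.
by apply: eq_lsum => n; rewrite big_cons.
Qed.

Lemma lsum_ge1 f n : (forall m, 0 <= f m) -> lsummable f -> f n <= lsum f.
Proof.
move=> f0 lf; rewrite -lee_fin lsum_ge0E//; apply: esum_ge.
by exists [set n]; rewrite ?fsbig_set1//; split.
Qed.

Lemma lsum_seq_le f (s : seq lattice) : (forall n, 0 <= f n) -> lsummable f ->
  uniq s -> \sum_(n <- s) f n <= lsum f.
Proof.
move=> f0 lf us; rewrite -lee_fin lsum_ge0E// -sumEFin; apply: esum_ge.
exists [set` s]; first by split => //; exact: finite_seq.
by rewrite -fsbig_seq.
Qed.

Lemma lsummable_bounded f (M : R) : (forall n, 0 <= f n) ->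
  (forall s : seq lattice, uniq s -> \sum_(n <- s) f n <= M) -> lsummable f.
Proof.
move=> f0 fM; apply: (@le_lt_trans _ _ M%:E); last exact: ltry.
apply: ge_ereal_sup => _ [A [fA _] <-].
rewrite fsbig_finite//= sumEFin lee_fin.
under eq_bigr do rewrite ger0_norm//.
by apply: fM; exact: finmap.fset_uniq.
Qed.

End LatticeSum.

(** * Complex numbers as a real plane *)

Section ComplexPlane.
Variable R : realType.
Implicit Types (z w : R[i]).

Definition nsq z : R := complex.Re z ^+ 2 + complex.Im z ^+ 2.
(** The real part of the Hermitian product $z\bar w$. It is enough for adjoints and for the
    quadratic forms of symmetric operators. *)
Definition rdot z w : R :=
  complex.Re z * complex.Re w + complex.Im z * complex.Im w.

Lemma nsq_ge0 z : 0 <= nsq z.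
Proof. by rewrite addr_ge0// sqr_ge0. Qed.

Lemma nsq_eq0 z : nsq z = 0 -> z = 0.
Proof.
case: z => a b /= /eqP; rewrite /nsq /= paddr_eq0 ?sqr_ge0//.
by rewrite !sqrf_eq0 => /andP[/eqP -> /eqP ->].
Qed.

Lemma nsqM z w : nsq (z * w) = nsq z * nsq w.
Proof. by case: z w => [a b] [c d]; rewrite /nsq /=; ring. Qed.

Lemma nsqC (x : R) : nsq x%:C = x ^+ 2.
Proof. by rewrite /nsq /= expr0n addr0. Qed.

Lemma nsqJ z : nsq z^* = nsq z.
Proof. by case: z => a b; rewrite /nsq /=; ring. Qed.

Lemma nsqN z : nsq (- z) = nsq z.
Proof. by case: z => a b; rewrite /nsq /=; ring. Qed.

Lemma nsqB z w : nsq (z - w) = nsq z + nsq w - 2 * rdot z w.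
Proof. by case: z w => [a b] [c d]; rewrite /nsq /rdot /=; ring. Qed.

Lemma nsqD_le z w : nsq (z + w) <= 2 * nsq z + 2 * nsq w.
Proof.
case: z w => [a b] [c d]; rewrite /nsq /=.
by have := sqr_ge0 (a - c); have := sqr_ge0 (b - d); nra.
Qed.

Lemma nsqB_le z w : nsq (z - w) <= 2 * nsq z + 2 * nsq w.
Proof. by rewrite -(nsqN w); exact: nsqD_le. Qed.

Lemma rdotxx z : rdot z z = nsq z.
Proof. by rewrite /rdot /nsq !expr2. Qed.

Lemma rdotC z w : rdot z w = rdot w z.
Proof. by rewrite /rdot; ring. Qed.

Lemma rdotDl z1 z2 w : rdot (z1 + z2) w = rdot z1 w + rdot z2 w.
Proof. by case: z1 z2 w => [a b] [c d] [e f]; rewrite /rdot /=; ring. Qed.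

Lemma rdotBl z1 z2 w : rdot (z1 - z2) w = rdot z1 w - rdot z2 w.
Proof. by case: z1 z2 w => [a b] [c d] [e f]; rewrite /rdot /=; ring. Qed.

Lemma rdotMl z w1 w2 : rdot (z * w1) w2 = rdot w1 (z^* * w2).
Proof. by case: z w1 w2 => [a b] [c d] [e f]; rewrite /rdot /=; ring. Qed.

Lemma rdotZl (x : R) z w : rdot (x%:C * z) w = x * rdot z w.
Proof. by case: z w => [a b] [c d]; rewrite /rdot /=; ring. Qed.

Lemma rdot_le z w : `|rdot z w| <= nsq z + nsq w.
Proof.
rewrite ler_norml; apply/andP; split; case: z w => [a b] [c d];
  rewrite /rdot /nsq /=; have := sqr_ge0 (a + c); have := sqr_ge0 (b + d);
  have := sqr_ge0 (a - c); have := sqr_ge0 (b - d);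
  have := sqr_ge0 a; have := sqr_ge0 b; have := sqr_ge0 c;
  have := sqr_ge0 d; nra.
Qed.

(** Coordinatewise, so that every limit is a limit of real sequences. *)
Definition cvgC (x : nat -> R[i]) (l : R[i]) : Prop :=
  (fun k => complex.Re (x k)) @ \oo --> complex.Re l /\
  (fun k => complex.Im (x k)) @ \oo --> complex.Im l.

Lemma cvgC_cst z : cvgC (fun=> z) z.
Proof. by split; exact: cvg_cst. Qed.

Let cvg_ext (f g : nat -> R) (a b : R) :
  f =1 g -> a = b -> f @ \oo --> a -> g @ \oo --> b.
Proof. by move=> /funext -> ->. Qed.

Lemma cvgCD x y l m : cvgC x l -> cvgC y m -> cvgC (fun k => x k + y k) (l + m).
Proof.
move=> [xR xI] [yR yI]; split.
- apply: cvg_ext (cvgD xR yR); last by case: l m {xR xI yR yI} => ? ? [].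
  by move=> k; rewrite fctE; case: (x k) (y k) => ? ? [].
- apply: cvg_ext (cvgD xI yI); last by case: l m {xR xI yR yI} => ? ? [].
  by move=> k; rewrite fctE; case: (x k) (y k) => ? ? [].
Qed.

Lemma cvgCM z x l : cvgC x l -> cvgC (fun k => z * x k) (z * l).
Proof.
case: z => a b [xR xI]; split.
- apply: (@cvg_ext (fun k => a * complex.Re (x k) - b * complex.Im (x k))
    _ (a * complex.Re l - b * complex.Im l)); last first.
  + by apply: cvgB; apply: cvgMl_tmp.
  + by case: l {xR xI}.
  + by move=> k; case: (x k) => c d.
- apply: (@cvg_ext (fun k => a * complex.Im (x k) + b * complex.Re (x k))
    _ (a * complex.Im l + b * complex.Re l)); last first.
  + by apply: cvgD; apply: cvgMl_tmp.
  + by case: l {xR xI}.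
  + by move=> k; case: (x k) => c d.
Qed.

Lemma cvgCB x y l m : cvgC x l -> cvgC y m -> cvgC (fun k => x k - y k) (l - m).
Proof.
move=> xl /(cvgCM (-1)); rewrite mulN1r => ym.
have := cvgCD xl ym; congr cvgC; apply/funext => k.
by rewrite mulN1r.
Qed.

Lemma cvgC_unique x l m : cvgC x l -> cvgC x m -> l = m.
Proof.
case: l m => [a b] [c d] [/= xR xI] [/= yR yI].
by rewrite (cvg_unique _ xR yR) ?(cvg_unique _ xI yI).
Qed.

Lemma cvgC_nsq x l : cvgC x l -> (fun k => nsq (x k)) @ \oo --> nsq l.
Proof. by move=> [xR xI]; apply: cvgD; rewrite expr2; apply: cvgM. Qed.

Lemma cvgC_geometric (x : nat -> R[i]) (C r : R) : 0 <= r < 1 -> 0 <= C ->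
  (forall k, nsq (x k.+1 - x k) <= C * r ^+ k) -> exists l, cvgC x l.
Proof.
move=> /andP[r0 r1] C0 xr.
have key (y : nat -> R) : (forall k, (y k.+1 - y k) ^+ 2 <= C * r ^+ k) ->
    exists l : R, y @ \oo --> l.
  move=> yr; suff : exists l : R, (series (telescope y)) @ \oo --> l.
    move=> [l H]; exists (y 0%N + l).
    apply: (@cvg_ext (fun k => y 0%N + series (telescope y) k) _ (y 0%N + l)).
    - by move=> k; rewrite [RHS]eq_sum_telescope.
    - by [].
    - by apply: cvgD => //; exact: cvg_cst.
  have : cvgn (series (telescope y)).
    suff H : cvgn (series (fun k => `|telescope y k|)) by exact: normed_cvg.
    (* The hypothesis bounds squares, so the increments themselves decay at the rate
       [Num.sqrt r]. *)
    apply: (@series_le_cvg _ _ (geometric (Num.sqrt C) (Num.sqrt r))).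
    - by move=> k; rewrite /= normr_ge0.
    - by move=> k /=; rewrite mulr_ge0 ?exprn_ge0 ?sqrtr_ge0.
    - move=> k; rewrite /telescope /geometric /=.
      rewrite -[leLHS]sqrtr_sqr ?real_normK ?num_real//.
      rewrite -(ler_sqr) ?nnegrE ?mulr_ge0 ?exprn_ge0 ?sqrtr_ge0//.
      rewrite sqr_sqrtr ?sqr_ge0// exprMn sqr_sqrtr// -exprM mulnC exprM.
      by rewrite sqr_sqrtr.
    apply: is_cvg_geometric_series.
    by rewrite ger0_norm ?sqrtr_ge0// -sqrtr1 ltr_sqrt.
  by move=> ct; eexists; exact: ct.
have [|lR HR] := key (fun k => complex.Re (x k)).
  move=> k; apply: le_trans (xr k); case: (x k.+1) (x k) => [a b] [c d].
  by rewrite /nsq /= lerDl sqr_ge0.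
have [|lI HI] := key (fun k => complex.Im (x k)).
  move=> k; apply: le_trans (xr k); case: (x k.+1) (x k) => [a b] [c d].
  by rewrite /nsq /= lerDr sqr_ge0.
by exists (lR +i* lI).
Qed.

End ComplexPlane.

(** * The operator on square summable functions *)

Section SquareSummable.
Variable R : realType.
Implicit Types (u v : lattice -> R[i]).

Definition sqnorm u : R := lsum (fun n => nsq (u n)).

Lemma normc_sq (z : R[i]) : Normc.normc z ^+ 2 = nsq z.
Proof. by rewrite normc2E. Qed.

Lemma l2P u : l2 u <-> lsummable (fun n => nsq (u n)).
Proof.
rewrite /l2 /lsummable /l2sq /=.
under eq_esum do rewrite normc_sq.
by under [X in _ <-> is_true (X < _)%E]eq_esum do rewrite ger0_norm ?nsq_ge0//.
Qed.

Lemma sqnorm_ge0 u : l2 u -> 0 <= sqnorm u.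
Proof.
by move=> /l2P u2; apply: lsum_ge0 => // n; exact: nsq_ge0.
Qed.

Lemma l2norm_sq u : l2 u -> l2norm u ^+ 2 = sqnorm u.
Proof.
move=> /l2P u2; rewrite /l2norm sqr_sqrtr; last first.
  by rewrite fine_ge0// l2sq_ge0.
rewrite -[RHS]/(fine (_)%:E) lsum_ge0E//; last by move=> n; exact: nsq_ge0.
by congr fine; apply: eq_esum => n _; rewrite normc_sq.
Qed.

Lemma l2_lsum_eq0 u : l2 u -> sqnorm u <= 0 -> u = fun=> 0.
Proof.
move=> /l2P u2 u0; apply/funext => n; apply: nsq_eq0; apply/eqP.
rewrite eq_le nsq_ge0 andbT (le_trans _ u0)//.
by apply: (lsum_ge1 n _ u2) => m; exact: nsq_ge0.
Qed.

Lemma l2D u v : l2 u -> l2 v -> l2 (fun n => u n + v n).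
Proof.
move=> /l2P u2 /l2P v2; apply/l2P.
apply: lsummable_le (lsummableD (lsummableZ 2 u2) (lsummableZ 2 v2)) => n.
by rewrite ger0_norm ?nsq_ge0// nsqD_le.
Qed.

Lemma l2Z (a : R[i]) u : l2 u -> l2 (fun n => a * u n).
Proof.
move=> /l2P u2; apply/l2P; apply: eq_lsummable (lsummableZ (nsq a) u2) => n.
by rewrite nsqM.
Qed.

Lemma l2B u v : l2 u -> l2 v -> l2 (fun n => u n - v n).
Proof.
move=> u2 /(l2Z (-1)) v2; have := l2D u2 v2; congr (l2 _).
by apply/funext => n; rewrite mulN1r.
Qed.

Lemma l2_0 : l2 (fun=> 0 : R[i]).
Proof.
apply/l2P; apply: eq_lsummable (lsummable0 R) => n.
by rewrite /nsq /= expr0n addr0.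
Qed.

Lemma l2_shift u a : l2 u -> l2 (fun n => u (n + a)).
Proof. by move=> /l2P u2; apply/l2P; exact: (lsummable_shift a u2). Qed.

Lemma lsummable_rdot u v : l2 u -> l2 v -> lsummable (fun n => rdot (u n) (v n)).
Proof.
move=> /l2P u2 /l2P v2; apply: lsummable_le (lsummableD u2 v2) => n.
exact: rdot_le.
Qed.

End SquareSummable.

Section Resolvent.
Variables (R : realType) (V : lattice -> R) (M : R).
Hypothesis VM : forall n, `|V n| <= M.
Implicit Types (u v : lattice -> R[i]) (z : R[i]).

Definition shifted z u : lattice -> R[i] := fun n => schrodinger V u n - z * u n.

Lemma shiftedD z u v :
  shifted z (fun n => u n + v n) = (fun n => shifted z u n + shifted z v n).
Proof. by apply/funext => n; rewrite /shifted /schrodinger /laplacian; ring. Qed.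

Lemma shiftedB z u v :
  shifted z (fun n => u n - v n) = (fun n => shifted z u n - shifted z v n).
Proof. by apply/funext => n; rewrite /shifted /schrodinger /laplacian; ring. Qed.

Lemma shiftedZ z a u :
  shifted z (fun n => a * u n) = (fun n => a * shifted z u n).
Proof. by apply/funext => n; rewrite /shifted /schrodinger /laplacian; ring. Qed.

Lemma supnorm_lty : (supnorm V < +oo)%E.
Proof.
apply: (@le_lt_trans _ _ M%:E); last exact: ltry.
by apply: ge_ereal_sup => _ [n _ <-]; rewrite lee_fin.
Qed.

Lemma l2_schrodinger u : l2 u -> l2 (schrodinger V u).
Proof. by case: (schrodinger_bounded supnorm_lty) => H _ _; exact: H. Qed.

Lemma l2_shifted z u : l2 u -> l2 (shifted z u).
Proof. by move=> u2; apply: l2B (l2_schrodinger u2) (l2Z z u2). Qed.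

Lemma shifted_bounded z : exists2 K : R, 0 < K & forall u, l2 u ->
  sqnorm (shifted z u) <= K * sqnorm u.
Proof.
have [_ _ [C HC]] := schrodinger_bounded supnorm_lty.
exists (2 * C ^+ 2 + 2 * nsq z + 1).
  by rewrite ltr_wpDl// addr_ge0// mulr_ge0 ?sqr_ge0 ?nsq_ge0.
move=> u u2; have Tu2 := l2_schrodinger u2.
have /l2P su := u2; have /l2P sT := Tu2; have /l2P ss := l2_shifted z u2.
have N0 := sqnorm_ge0 u2.
have TC : sqnorm (schrodinger V u) <=
    C ^+ 2 * sqnorm u.
  rewrite -!l2norm_sq// -exprMn ler_sqr ?nnegrE ?HC// ?sqrtr_ge0//.
  by rewrite (le_trans _ (HC _ u2))// sqrtr_ge0.
apply: (@le_trans _ _ (lsum (fun n =>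
    2 * nsq (schrodinger V u n) + 2 * nsq z * nsq (u n)))).
  apply: le_lsum => //.
    by apply: lsummableD; exact: lsummableZ.
  by move=> n; apply: le_trans (nsqB_le _ _) _; rewrite nsqM mulrA.
rewrite lsumD ?lsumZ//; try exact: lsummableZ.
rewrite -!/(sqnorm _); nra.
Qed.

(** The adjoint of a translation is the opposite translation, so symmetry merely permutes the four
    hopping terms. *)
Lemma schrodinger_sym u v : l2 u -> l2 v ->
  lsum (fun n => rdot (schrodinger V u n) (v n)) =
  lsum (fun n => rdot (u n) (schrodinger V v n)).
Proof.
pose hop (a : lattice) u v := lsum (fun n => rdot (u (n + a)) (v n)).
have expand u' v' : l2 u' -> l2 v' ->
    lsum (fun n => rdot (schrodinger V u' n) (v' n)) =
    hop (- (1, 0)) u' v' + hop (1, 0) u' v' +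
    (hop (- (0, 1)) u' v' + hop (0, 1) u' v') +
    lsum (fun n => V n * rdot (u' n) (v' n)).
  move=> u2 v2.
  have h a : lsummable (fun n => rdot (u' (n + a)) (v' n)).
    by apply: lsummable_rdot => //; exact: l2_shift.
  have hV : lsummable (fun n => V n * rdot (u' n) (v' n)).
    apply: lsummable_le (lsummableZ M (lsummable_norm (lsummable_rdot u2 v2))).
    by move=> n; rewrite normrM ler_wpM2r.
  have h1 := lsummableD (h (- (1, 0))) (h (1, 0)).
  have h2 := lsummableD (h (- (0, 1))) (h (0, 1)).
  rewrite /hop -(lsumD (h _) (h _)) -(lsumD (h _) (h _)) -(lsumD h1 h2).
  rewrite -(lsumD (lsummableD h1 h2) hV).
  apply: eq_lsum => n; rewrite /schrodinger /laplacian.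
  by rewrite !rdotDl rdotZl.
have swap a u' v' : hop a u' v' = hop (- a) v' u'.
  rewrite /hop -(lsum_shift _ (- a)); apply: eq_lsum => n.
  by rewrite addrNK rdotC.
move=> u2 v2; rewrite expand// (eq_lsum (f := fun n => rdot (u n) _)
  (g := fun n => rdot (schrodinger V v n) (u n))); last first.
  by move=> n; rewrite rdotC.
rewrite expand// (swap _ u v) (swap (1, 0) u v) (swap (- (0, 1)) u v).
rewrite (swap (0, 1) u v) !opprK.
rewrite (eq_lsum (f := fun n => V n * rdot (v n) (u n))
  (g := fun n => V n * rdot (u n) (v n))); last by move=> n; rewrite rdotC.
ring.
Qed.

Lemma shifted_adj z u v : l2 u -> l2 v ->
  lsum (fun n => rdot (shifted z u n) (v n)) =
  lsum (fun n => rdot (u n) (shifted z^* v n)).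
Proof.
move=> u2 v2.
have Tu := l2_schrodinger u2; have Tv := l2_schrodinger v2.
transitivity (lsum (fun n => rdot (schrodinger V u n) (v n) -
                             rdot (u n) (z^* * v n))).
  by apply: eq_lsum => n; rewrite rdotBl rdotMl.
rewrite lsumB ?schrodinger_sym//; try by apply: lsummable_rdot => //; exact: l2Z.
rewrite -lsumB; try by apply: lsummable_rdot => //; exact: l2Z.
by apply: eq_lsum => n; rewrite ![rdot (u n) _]rdotC -rdotBl.
Qed.

Lemma bounded_below_spectrum z : ~ spectrum (schrodinger V) z ->
  exists2 c : R, 0 < c & forall u, l2 u ->
    c * sqnorm u <= sqnorm (shifted z u).
Proof.
move=> /contrapT[S [[Sl2 _ [C SC]] Sinv]].
(* [C] bounds the resolvent and may be 0 or negative; squaring and adding 1 gives a positive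
   constant. *)
exists (C ^+ 2 + 1)^-1; first by rewrite invr_gt0 ltr_wpDl// sqr_ge0.
move=> u u2; have w2 := l2_shifted z u2.
rewrite ler_pdivrMl; last by rewrite ltr_wpDl// sqr_ge0.
have [Su _] := Sinv u u2.
have := SC _ w2; rewrite Su => H.
have N0 := sqnorm_ge0 w2.
have : l2norm u ^+ 2 <= (C * l2norm (shifted z u)) ^+ 2.
  by rewrite ler_sqr ?nnegrE ?sqrtr_ge0// (le_trans _ H)// sqrtr_ge0.
rewrite exprMn !l2norm_sq// => /le_trans; apply.
by rewrite mulrDl mul1r lerDl.
Qed.

End Resolvent.

(** * Bounded below operators are invertible *)

Section Inversion.
Variables (R : realType) (V : lattice -> R) (M : R).
Hypothesis VM : forall n, `|V n| <= M.
Implicit Types (u v w : lattice -> R[i]) (z : R[i]).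

Let l2s := l2_shifted VM.

(** Summing $|w-cu|^2\ge 0$ gives $\|w\|^2+c^2\|u\|^2\ge 2c\langle w,u\rangle\ge 2c^2\|u\|^2$. *)
Lemma coercive_bounded_below (c : R) u w : 0 <= c -> l2 u -> l2 w ->
  c * sqnorm u <= lsum (fun n => rdot (w n) (u n)) ->
  c ^+ 2 * sqnorm u <= sqnorm w.
Proof.
move=> c0 u2 w2 cuw.
have /l2P su := u2; have /l2P sw := w2; have swu := lsummable_rdot w2 u2.
have H : lsum (fun n => nsq (w n) + c ^+ 2 * nsq (u n)) >=
    lsum (fun n => 2 * c * rdot (w n) (u n)).
  apply: le_lsum; first exact: lsummableZ.
    by apply: lsummableD => //; exact: lsummableZ.
  move=> n; have := nsq_ge0 (w n - c%:C * u n).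
  by rewrite nsqB rdotC rdotZl nsqM nsqC rdotC; lra.
move: H; rewrite lsumD ?lsumZ//; last exact: lsummableZ.
rewrite -!/(sqnorm _); nra.
Qed.

Section Neumann.
Variables (z : R[i]) (c : R).
Hypothesis c0 : 0 < c.
Hypothesis below :
  forall v, l2 v -> c * sqnorm v <= sqnorm (shifted V z^* v).

Let AB v := shifted V z (shifted V z^* v).

Let AB2 v : l2 v -> l2 (AB v).
Proof. by move=> v2; do 2 apply: l2s. Qed.

Let ABdot v : l2 v ->
  lsum (fun n => rdot (AB v n) (v n)) = sqnorm (shifted V z^* v).
Proof.
by move=> v2; rewrite (shifted_adj VM)//; exact: l2s.
Qed.

(* For [t] small, [1 - t A A^*] is a contraction when [A^*] is bounded below,
   so the Richardson iteration for [A A^* v = u] converges. *)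
Let richardson_contraction : exists t r : R, [/\ 0 < t, 0 <= r < 1 &
  forall v, l2 v -> sqnorm (fun n => v n - t%:C * AB v n) <= r * sqnorm v].
Proof.
have [K K0 HK] := shifted_bounded VM z.
have cK : 0 < K + c by rewrite addr_gt0.
(* Expanding, $\|v-tAA^*v\|^2\le\|v\|^2-t(2-tK)\|A^*v\|^2$. With $tK\le 1$ this is at most
   $(1-tc)\|v\|^2$; taking $K+c$ instead of $K$ in the denominator keeps this factor nonnegative. *)
exists (K + c)^-1, (1 - (K + c)^-1 * c); split.
- by rewrite invr_gt0.
- rewrite mulrC; apply/andP; split.
    by rewrite subr_ge0 ler_pdivrMr// mul1r; lra.
  by rewrite ltrBlDr ltrDl divr_gt0.
move=> v v2; set t := (K + c)^-1.
have t0 : 0 < t by rewrite invr_gt0.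
have w2 := AB2 v2; have b2 := l2s z^* v2.
have /l2P sv := v2; have /l2P sw := w2; have /l2P sb := b2.
have swv := lsummable_rdot w2 v2.
have -> : sqnorm (fun n => v n - t%:C * AB v n) =
    lsum (fun n => (nsq (v n) + t ^+ 2 * nsq (AB v n))
      - 2 * t * rdot (AB v n) (v n)).
  by apply: eq_lsum => n; rewrite nsqB nsqM nsqC rdotC rdotZl; ring.
rewrite lsumB; last 2 first.
- by apply: lsummableD => //; exact: lsummableZ.
- exact: lsummableZ.
rewrite lsumD//; last exact: lsummableZ.
rewrite !lsumZ// ABdot// -!/(sqnorm _).
have := HK _ b2; rewrite -/(AB v) => h1; have := below v2 => h2.
have h3 : t * (K + c) = 1 by rewrite mulVf// gt_eqF.
set x := sqnorm v in h1 h2 *; set y := sqnorm (shifted V z^* v) in h1 h2 *.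
set a := sqnorm (AB v) in h1 *.
have y0 : 0 <= y by exact: sqnorm_ge0.
have h4 : t ^+ 2 * a <= t * y.
  apply: (@le_trans _ _ (t ^+ 2 * (K * y))); first by rewrite ler_wpM2l ?sqr_ge0.
  have tK : t * K <= 1 by rewrite -h3 mulrDr lerDl mulr_ge0// ltW.
  rewrite (_ : t ^+ 2 * (K * y) = t * (t * K * y)); last by ring.
  by apply: ler_wpM2l; [exact: ltW|rewrite ler_piMl].
have h5 : t * (c * x) <= t * y by apply: ler_wpM2l => //; exact: ltW.
lra.
Qed.

(** The iterates only have to converge at each lattice point: the operator has finite range, so the
    equation passes to pointwise limits, and the limit is square summable because its finite partial
    sums inherit the uniform bound [xM]. *)
Lemma shifted_normal_surj u : l2 u -> exists2 v, l2 v & AB v = u.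
Proof.
move=> u2; have [t [r [t0 r01 contr]]] := richardson_contraction.
have /andP[r0 r1] := r01.
pose step v : lattice -> R[i] := fun n => v n - t%:C * (AB v n - u n).
pose x k := iter k step (fun=> 0).
have x2 k : l2 (x k).
  elim: k => [|k IH]; first exact: l2_0.
  by apply: l2B => //; apply: l2Z; apply: l2B => //; exact: AB2.
pose d k : lattice -> R[i] := fun n => x k.+1 n - x k n.
have d2 k : l2 (d k) by exact: l2B.
have dE k n : d k n = - (t%:C * (AB (x k) n - u n)).
  by rewrite /d /x iterS -/(x k) {1}/step; ring.
have dS k : d k.+1 = fun n => d k n - t%:C * AB (d k) n.
  apply/funext => n.
  have -> : AB (d k) n = AB (x k.+1) n - AB (x k) n by rewrite /AB /d !shiftedB.
  by rewrite !dE; ring.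
have dr k : sqnorm (d k) <= sqnorm (d 0%N) * r ^+ k.
  elim: k => [|k IH]; first by rewrite expr0 mulr1.
  rewrite dS (le_trans (contr _ (d2 k)))// exprS mulrCA ler_wpM2l//.
have /choice[v Hv] : forall n, exists l, cvgC (fun k => x k n) l.
  move=> n; apply: (@cvgC_geometric _ _ (sqnorm (d 0%N)) r) => //.
    exact: sqnorm_ge0.
  move=> k; apply: le_trans (dr k).
  have /l2P := d2 k; rewrite /sqnorm => sd.
  by apply: (lsum_ge1 n _ sd) => m; exact: nsq_ge0.
have resid k : sqnorm (fun n => AB (x k) n - u n) <= sqnorm u.
  have -> : sqnorm (fun n => AB (x k) n - u n) = t ^- 2 * sqnorm (d k).
    transitivity (lsum (fun n => t ^- 2 * nsq (d k n))); last first.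
      exact: lsumZ (proj1 (l2P _) (d2 k)).
    apply: eq_lsum => n; rewrite dE nsqN nsqM nsqC mulKf//.
    by rewrite sqrf_eq0 gt_eqF.
  have -> : sqnorm u = t ^- 2 * sqnorm (d 0%N).
    transitivity (lsum (fun n => t ^- 2 * nsq (d 0%N n))); last first.
      exact: lsumZ (proj1 (l2P _) (d2 0%N)).
    apply: eq_lsum => n; rewrite dE /=.
    have -> : AB (fun=> 0) n = 0.
      by rewrite /AB /shifted /schrodinger /laplacian; ring.
    rewrite sub0r nsqN nsqM nsqC nsqN mulKf//.
    by rewrite sqrf_eq0 gt_eqF.
  rewrite ler_wpM2l ?invr_ge0 ?sqr_ge0// (le_trans (dr k))//.
  by rewrite ler_piMr ?sqnorm_ge0// exprn_ile1// ltW.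
(* Coercivity bounds $c^2\|x_k\|^2$ by $\|AA^*x_k\|^2$; splitting off the residual bounds this by
   $2\|u\|^2+2\|u\|^2$. *)
have xM k : sqnorm (x k) <= c ^- 2 * (4 * sqnorm u).
  rewrite ler_pdivlMl ?exprn_gt0//.
  apply: (@le_trans _ _ (sqnorm (AB (x k)))).
    apply: coercive_bounded_below; [exact: ltW|exact: x2|exact: AB2|].
    by rewrite ABdot//; exact: below.
  have r2 : l2 (fun n => AB (x k) n - u n) by apply: l2B => //; exact: AB2.
  have /l2P sr := r2; have /l2P su := u2; have /l2P sa := AB2 (x2 k).
  apply: (@le_trans _ _ (lsum (fun n =>
      2 * nsq (AB (x k) n - u n) + 2 * nsq (u n)))).
    apply: le_lsum => //; first by apply: lsummableD; exact: lsummableZ.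
    by move=> n; rewrite -{1}(subrK (u n) (AB (x k) n)) nsqD_le.
  rewrite lsumD ?lsumZ//; try exact: lsummableZ.
  rewrite -!/(sqnorm _); have := resid k; rewrite /sqnorm; lra.
exists v.
  apply/l2P; apply: (@lsummable_bounded _ _ (c ^- 2 * (4 * sqnorm u))).
    by move=> n; exact: nsq_ge0.
  move=> s us.
  have : (fun k => \sum_(n <- s) nsq (x k n)) @ \oo --> \sum_(n <- s) nsq (v n).
    apply: cvg_big => [|n _]; last exact: cvgC_nsq.
    by move=> ?; exact: add_continuous.
  move=> /cvgr_to_le; apply; apply: nearW => k; apply: le_trans (xM k).
  have /l2P sx := x2 k.
  by apply: lsum_seq_le => // n; exact: nsq_ge0.
have cvgS w (y : nat -> lattice -> R[i]) : (forall n, cvgC (y ^~ n) (w n)) ->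
    forall z n, cvgC (fun k => shifted V z (y k) n) (shifted V z w n).
  move=> yw z' n; rewrite /shifted /schrodinger /laplacian.
  by apply: cvgCB; [apply: cvgCD; [do 2 apply: cvgCD|]|]; rewrite //; exact: cvgCM.
(* The scaled residual is [x k n - x k.+1 n], a difference of two sequences with the same limit. *)
have lim0 n : cvgC (fun k => t%:C * (AB (x k) n - u n)) 0.
  have H1 : cvgC (fun k => x k.+1 n) (v n).
    by have [HR HI] := Hv n; split; [have := HR|have := HI];
       rewrite -cvg_shiftS.
  have := cvgCB (Hv n) H1; rewrite subrr; congr cvgC; apply/funext => k.
  by rewrite -opprB -/(d k n) dE opprK.
apply/funext => n.
have H : cvgC (fun k => t%:C * (AB (x k) n - u n)) (t%:C * (AB v n - u n)).
  apply: cvgCM; apply: cvgCB; last exact: cvgC_cst.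
  by apply: (cvgS _ _ _) => m; exact: cvgS.
have /eqP := cvgC_unique H (lim0 n).
rewrite mulf_eq0 eq_complex /= gt_eqF//= subr_eq0 => /eqP.
by [].
Qed.
End Neumann.

(** The bound at [z] gives injectivity and a bounded inverse; the bound at [z^*], through $AA^*$,
    gives surjectivity. *)
Lemma not_spectrum z (c : R) : 0 < c ->
  (forall v, l2 v -> c * sqnorm v <= sqnorm (shifted V z v)) ->
  (forall v, l2 v -> c * sqnorm v <= sqnorm (shifted V z^* v)) ->
  ~ spectrum (schrodinger V) z.
Proof.
move=> c0 bz bzJ; apply; rewrite -/(shifted _ _).
have inj v w : l2 v -> l2 w -> shifted V z v = shifted V z w -> v = w.
  move=> v2 w2 vw; have d2 := l2B v2 w2.
  have : (fun n => v n - w n) = fun=> 0.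
    apply: l2_lsum_eq0 => //; rewrite -(ler_pM2l c0) mulr0.
    rewrite (le_trans (bz _ d2))// shiftedB vw /sqnorm.
    rewrite (eq_lsum (g := fun=> 0)) ?lsum0// => n.
    by rewrite subrr /nsq /= expr0n addr0.
  move=> H; apply/funext => n; apply/eqP; rewrite -subr_eq0; apply/eqP.
  exact: (congr1 (@^~ n) H).
have surj u : exists v, l2 u -> l2 v /\ shifted V z v = u.
  (* Operators are total maps on lattice functions: outside $\ell^2$ the chosen preimage is a junk
     value. *)
  have [u2|nu2] := pselect (l2 u); last by exists u.
  have [v v2 ABv] := shifted_normal_surj c0 bzJ u2.
  by exists (shifted V z^* v) => _; split => //; exact: l2s.
have [S HS] := choice surj; exists S; split; last first.
  move=> u u2; have [Tu2 _] := (HS _ (l2s z u2)); split.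
    by apply: inj => //; have [_ ->] := HS _ (l2s z u2).
  by have [_ ] := HS _ u2.
split.
- by move=> u /HS[].
- move=> a u v u2 v2; have [Su2 Su] := HS u u2; have [Sv2 Sv] := HS v v2.
  have auv2 : l2 (fun n => a * u n + v n) by apply: l2D => //; exact: l2Z.
  have [S2 SE] := HS _ auv2.
  apply: inj => //; first by apply: l2D => //; exact: l2Z.
  by rewrite SE shiftedD shiftedZ Su Sv.
exists (Num.sqrt c^-1) => u u2; have [Su2 Su] := HS u u2.
rewrite -ler_sqr ?nnegrE ?mulr_ge0 ?sqrtr_ge0//.
rewrite exprMn !l2norm_sq// sqr_sqrtr; last by rewrite invr_ge0 ltW.
by rewrite ler_pdivlMl// -{2}Su; exact: bz.
Qed.

(** Symmetry of $T-a$ makes $\mathrm{Re}\langle (T-a)u,iu\rangle$ vanish, so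
    $\|(T-a-ib)u\|^2=\|(T-a)u\|^2+b^2\|u\|^2$. The same bound holds for $-b$, that is, at the
    conjugate point. *)
Lemma spectrum_real z : spectrum (schrodinger V) z -> complex.Im z = 0.
Proof.
move=> sz; apply: contrapT => /eqP; move: sz; case: z => a b /= sz b0.
apply: sz; apply: contrapT.
have below b' u : l2 u -> b' ^+ 2 * sqnorm u <= sqnorm (shifted V (a +i* b') u).
  move=> u2; have w2 := l2s a%:C u2.
  have /l2P su := u2; have /l2P sw := w2.
  have iu2 : l2 (fun n => 'i * u n) by exact: l2Z.
  have sd := lsummable_rdot w2 iu2.
  have E : sqnorm (shifted V (a +i* b') u) = lsum (fun n =>
      (nsq (shifted V a%:C u n) + b' ^+ 2 * nsq (u n))
      - 2 * b' * rdot (shifted V a%:C u n) ('i * u n)).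
    apply: eq_lsum => n; rewrite /shifted.
    case: (schrodinger V u n) (u n) => [x y] [s t].
    by rewrite /nsq /rdot /=; ring.
  rewrite E lsumB; last 2 first.
  - by apply: lsummableD => //; exact: lsummableZ.
  - exact: lsummableZ.
  rewrite lsumD//; last exact: lsummableZ.
  rewrite !lsumZ//.
  have -> : lsum (fun n => rdot (shifted V a%:C u n) ('i * u n)) = 0.
    have aJ : (a%:C)^* = a%:C :> R[i] by exact: conjc_real.
    have := shifted_adj VM a%:C u2 iu2; rewrite aJ shiftedZ => H.
    have : lsum (fun n => rdot (u n) ('i * shifted V a%:C u n)) =
        lsum (fun n => - rdot (shifted V a%:C u n) ('i * u n)).
      apply: eq_lsum => n; case: (u n) (shifted V a%:C u n) => [? ?] [? ?].
      by rewrite /rdot /=; ring.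
    by rewrite lsumN// -H; lra.
  by rewrite -!/(sqnorm _) mulr0 subr0 lerDr sqnorm_ge0.
by apply: (@not_spectrum _ (b ^+ 2)); rewrite ?exprn_even_gt0 ?b0//=;
  move=> v v2; [|rewrite -sqrrN]; exact: below.
Qed.

End Inversion.

(** * Bloch waves as approximate eigenfunctions *)

Section Weights.
Variable R : realType.

Definition dist0 (n : lattice) : nat := (`|n.1| + `|n.2|)%N.

Lemma dist0D (n m : lattice) : (dist0 (n + m)%R <= dist0 n + dist0 m)%N.
Proof. by case: n m => [a b] [c d]; rewrite /dist0 /=; lia. Qed.

Lemma dist0N (n : lattice) : dist0 (- n) = dist0 n.
Proof. by case: n => [a b]; rewrite /dist0 /= !abszN. Qed.

Lemma ler_sum_sub_uniq (I : eqType) (s t : seq I) (f : I -> R) :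
  (forall i, 0 <= f i) -> uniq s -> uniq t -> {subset s <= t} ->
  \sum_(i <- s) f i <= \sum_(i <- t) f i.
Proof.
move=> f0 us ut st; rewrite -(perm_big _ (permEl (perm_filterC (mem s) t))) /=.
rewrite big_cat /= (perm_big [seq i <- t | i \in s]) /=.
  by rewrite lerDl sumr_ge0.
apply: uniq_perm => // [|i]; first exact: filter_uniq.
by rewrite mem_filter; case: (boolP (i \in s)) => // /st ->.
Qed.

Lemma geometric_sum_le (r : R) N : 0 <= r < 1 ->
  \sum_(k <- iota 0 N) r ^+ k <= (1 - r)^-1.
Proof.
move=> /andP[r0 r1]; have d0 : 0 < 1 - r by rewrite subr_gt0.
rewrite -[leRHS]mul1r ler_pdivlMr//.
have -> : iota 0 N = index_iota 0 N by rewrite /index_iota subn0.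
rewrite big_mkord mulrC -opprB mulNr -subrX1 opprB lerBlDr lerDl.
exact: exprn_ge0.
Qed.

Lemma lsummable_geometric (r : R) : 0 <= r < 1 ->
  lsummable (fun n => r ^+ dist0 n).
Proof.
move=> r01; have /andP[r0 r1] := r01.
(* [Negz k] is $-(k+1)$, so [rng N] lists the integers from $-N$ to $N-1$. *)
pose rng N := map Posz (iota 0 N) ++ map Negz (iota 0 N).
have urng N : uniq (rng N).
  rewrite cat_uniq !map_inj_uniq ?iota_uniq //=; try by move=> ? ? [].
  rewrite andbT; apply/hasPn => _ /mapP[k _ ->].
  by apply/negP => /mapP[].
have in_rng N (i : int) : (`|i| < N)%N -> i \in rng N.
  move=> iN; rewrite mem_cat; case: i iN => k /= kN.
    by rewrite map_f// mem_iota.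
  by rewrite orbC map_f// mem_iota /= (leq_trans _ kN).
have sum_rng N : \sum_(i <- rng N) r ^+ `|i| <= 2 * (1 - r)^-1.
  rewrite big_cat !big_map /= mulr_natl mulr2n lerD ?geometric_sum_le//.
  rewrite (le_trans _ (geometric_sum_le N r01))//.
  by apply: ler_sum => k _; rewrite exprS ler_piMl ?exprn_ge0// ltW.
apply: (@lsummable_bounded _ _ ((2 * (1 - r)^-1) ^+ 2)).
  by move=> n; rewrite exprn_ge0.
move=> s us; pose N := (\max_(n <- s) dist0 n).+1.
have sN n : n \in s -> (dist0 n < N)%N by move=> ns; exact: leq_bigmax_seq.
apply: (@le_trans _ _ (\sum_(n <- [seq (i, j) | i <- rng N, j <- rng N])
    r ^+ dist0 n)).
  apply: ler_sum_sub_uniq => //; first by move=> i; exact: exprn_ge0.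
    by apply: allpairs_uniq => // -[? ?] [? ?].
  move=> [i j] /sN ijN; apply/allpairsP; exists (i, j); split=> //=;
    by apply: in_rng; apply: leq_ltn_trans ijN; rewrite /dist0 ?leq_addr ?leq_addl.
rewrite big_allpairs /=.
rewrite (_ : \sum_(i <- _) _ = (\sum_(i <- rng N) r ^+ `|i|) *
    \sum_(j <- rng N) r ^+ `|j|).
  have N0 : 0 <= \sum_(i <- rng N) r ^+ `|i|.
    by apply: sumr_ge0 => i _; exact: exprn_ge0.
  by rewrite -expr2 ler_sqr ?nnegrE// (le_trans N0).
rewrite mulr_suml; apply: eq_bigr => i _; rewrite mulr_sumr.
by apply: eq_bigr => j _; rewrite exprD.
Qed.

Lemma bernoulli_le (x : R) n : 0 <= x <= 1 -> 1 - n%:R * x <= (1 - x) ^+ n.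
Proof.
move=> /andP[x0 x1]; elim: n => [|n IH]; first by rewrite expr0; lra.
rewrite exprS (le_trans _ (ler_wpM2l _ IH)) ?subr_ge0//.
by rewrite -natr1; have := mulr_ge0 (mulr_ge0 (ler0n R n) x0) x0; nra.
Qed.

End Weights.

Section BlochLowerBound.
Variables (R : realType) (V : lattice -> R) (M : R).
Hypothesis VM : forall n, `|V n| <= M.

Variables (I : finType) (h : I -> lattice) (i0 : I) (m : nat).
Hypothesis hi0 : h i0 = 0.
Hypothesis hm : forall i, (dist0 (h i) <= m)%N.

Variables (z : R[i]) (c : R).
Hypothesis c0 : 0 < c.
Hypothesis below :
  forall v, l2 v -> c * sqnorm v <= sqnorm (shifted V z v).

(* Test the lower bound on [w phi] with [w n = (1 - x) ^ |n|] decaying so slowly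
   that [T - z] almost commutes with [w]; averaging over translates by [h]
   decouples [w] from [phi]. *)
Lemma bloch_bounded_below (phi : lattice -> R[i]) (A B : R) :
  (forall n, \sum_i nsq (phi (n + h i)) = A) ->
  (forall n, \sum_i nsq (shifted V z phi (n + h i)) = B) ->
  c / 16 * A <= B.
Proof.
move=> phiA psiB; set psi := shifted V z phi in psiB.
have A0 : 0 <= A.
  by rewrite -(phiA 0); apply: sumr_ge0 => i _; exact: nsq_ge0.
have phi_le n : nsq (phi n) <= A.
  rewrite -(phiA n) (bigD1 i0)//= hi0 addr0 lerDl.
  by apply: sumr_ge0 => i _; exact: nsq_ge0.
have psi_le n : nsq (psi n) <= B.
  rewrite -(psiB n) (bigD1 i0)//= hi0 addr0 lerDl.
  by apply: sumr_ge0 => i _; exact: nsq_ge0.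
have [k kE k0] : exists2 k : R, k = #|I|%:R & 0 < k.
  by exists #|I|%:R => //; rewrite ltr0n; apply/card_gt0P; exists i0.
(* [x] is the decay rate of the weight: [x <= 4^-1] controls its relative variation over one step,
   the third bound its variation over the translates by [h], and the last lets the commutator be
   absorbed. *)
have [x [x0 x4 xm xk]] : exists x : R, [/\ 0 < x, x <= 4^-1,
    (2 * m)%:R * x <= 2^-1 & 128 * k * x ^+ 2 <= c / 4].
  have m0 : 0 < m.+1%:R :> R by rewrite ltr0n.
  have mm : m%:R < m.+1%:R :> R by rewrite ltr_nat.
  have := c0 => c0'.
  have [D DE D0] : exists2 D : R, D = 512 * k & 0 < D.
    by exists (512 * k); [exact: erefl|lra].
  have [l lE l0] : exists2 l : R, l = 4 * m.+1%:R & 0 < l.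
    by exists (4 * m.+1%:R); [exact: erefl|lra].
  have [x [x0 x4 xl xD]] : exists x : R,
      [/\ 0 < x, x <= 4^-1, x <= l^-1 & x <= c / D].
    exists (Num.min 4^-1 (Num.min l^-1 (c / D))); split.
    - by rewrite !lt_min !invr_gt0 l0 divr_gt0// andbT; lra.
    - by rewrite ge_min lexx.
    - by rewrite !ge_min lexx orbT.
    - by rewrite !ge_min lexx !orbT.
  exists x; split=> //.
    have H : x * l <= 1 by rewrite -ler_pdivlMr// mul1r.
    rewrite natrM; nra.
  have H : x * D <= c by rewrite -ler_pdivlMr.
  have : x * (x * D) <= x * c by rewrite ler_wpM2l// ltW.
  by rewrite DE; nra.
pose r := 1 - x.
have r01 : 0 <= r < 1 by rewrite /r; apply/andP; split; lra.
have /andP[r0 r1] := r01.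
have rm : 2^-1 <= r ^+ (2 * m).
  apply: le_trans (bernoulli_le _ _); first by lra.
  by apply/andP; split; lra.
pose w n := r ^+ dist0 n.
have w0 n : 0 < w n by rewrite exprn_gt0// /r; lra.
have w0' n : 0 <= w n by exact: ltW.
have wD n a : w n * w a <= w (n + a).
  rewrite -exprD; apply: ler_wiXn2l; rewrite ?(ltW r1)//; exact: dist0D.
have wD' n a : w (n + a) * w a <= w n.
  by have := wD (n + a) (- a); rewrite addrK /w dist0N.
have wstep n a : dist0 a = 1%N -> `|w (n + a) - w n| <= 2 * x * w n.
  move=> a1; have wa : w a = r by rewrite /w a1.
  have := wD n a; have := wD' n a; rewrite wa ler_norml /r => h1 h2.
  have := w0 n; have := w0 (n + a) => h3 h4; nra.
have sw2 : lsummable (fun n => w n ^+ 2).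
  apply: eq_lsummable (@lsummable_geometric R (r ^+ 2) _) => [n|].
    by rewrite -!exprM mulnC.
  by rewrite sqr_ge0 exprn_ilt1.
pose W := lsum (fun n => w n ^+ 2).
have W0 : 0 < W.
  apply: lt_le_trans (lsum_ge1 0 _ sw2); first by rewrite exprn_gt0.
  by move=> n; rewrite sqr_ge0.
have c0' := c0.
(* Under the translates by [h] the squared weight changes by a factor at most 2, so replacing [f] by
   its constant sum [F] over translates also costs at most 2, in either direction. *)
have avg (f : lattice -> R) (F : R) : (forall n, 0 <= f n <= F) ->
    (forall n, \sum_i f (n + h i) = F) ->
    let S := lsum (fun n => w n ^+ 2 * f n) in
    [/\ lsummable (fun n => w n ^+ 2 * f n), F * W <= 2 * (k * S) &
        k * S <= 2 * (F * W)].
  move=> f0F fF S.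
  have sf : lsummable (fun n => w n ^+ 2 * f n).
    apply: lsummable_le (lsummableZ F sw2) => n.
    have /andP[f0 fle] := f0F n.
    have wf0 : 0 <= w n ^+ 2 * f n by rewrite mulr_ge0 ?sqr_ge0.
    by rewrite ger0_norm// mulrC; apply: ler_wpM2r => //; exact: sqr_ge0.
  have kS : k * S = lsum (fun n => \sum_i (w (n + h i) ^+ 2 * f (n + h i))).
    rewrite lsum_sum; last first.
      by move=> i; exact: (lsummable_shift (h i) sf).
    rewrite (eq_bigr (fun=> S)); first by rewrite sumr_const -mulr_natl kE.
    by move=> i _; exact: (lsum_shift (fun n => w n ^+ 2 * f n) (h i)).
  have ss : lsummable (fun n => \sum_i (w (n + h i) ^+ 2 * f (n + h i))).
    by apply: lsummable_sum => i; exact: (lsummable_shift (h i) sf).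
  have whr i : 2^-1 <= w (h i) ^+ 2.
    have -> : w (h i) ^+ 2 = r ^+ (2 * dist0 (h i)) by rewrite -exprM mulnC.
    apply: le_trans rm _; apply: ler_wiXn2l => //; first exact: ltW.
    by rewrite leq_mul2l hm.
  split=> //.
    rewrite kS -!lsumZ//; apply: le_lsum; try exact: lsummableZ.
    move=> n; rewrite -(fF n) mulr_suml mulr_sumr; apply: ler_sum => i _.
    have /andP[f0 _] := f0F (n + h i).
    have H : w n ^+ 2 * w (h i) ^+ 2 <= w (n + h i) ^+ 2.
      by rewrite -exprMn; apply: lerXn2r; rewrite ?nnegrE ?mulr_ge0.
    have H1 : w n ^+ 2 <= 2 * w (n + h i) ^+ 2.
      by have := ler_wpM2l (sqr_ge0 (w n)) (whr i); lra.
    by have := ler_wpM2r f0 H1; lra.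
  have -> : 2 * (F * W) = lsum (fun n => 2 * F * w n ^+ 2).
    by rewrite (lsumZ _ sw2) mulrA.
  rewrite kS; apply: le_lsum => //; first exact: lsummableZ.
  move=> n; rewrite -mulrA -(fF n) mulr_suml mulr_sumr; apply: ler_sum => i _.
  have /andP[f0 _] := f0F (n + h i).
  have H : w (n + h i) ^+ 2 * w (h i) ^+ 2 <= w n ^+ 2.
    by rewrite -exprMn; apply: lerXn2r; rewrite ?nnegrE ?mulr_ge0.
  have H1 : w (n + h i) ^+ 2 <= 2 * w n ^+ 2.
    by have := ler_wpM2l (sqr_ge0 (w (n + h i))) (whr i); lra.
  by have := ler_wpM2r f0 H1; lra.
have [|s1 lo1 hi1] := avg (fun n => nsq (phi n)) A _ phiA.
  by move=> n; rewrite nsq_ge0 phi_le.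
have [|s2 lo2 hi2] := avg (fun n => nsq (psi n)) B _ psiB.
  by move=> n; rewrite nsq_ge0 psi_le.
pose u n := (w n)%:C * phi n.
have uE : (fun n => nsq (u n)) = (fun n => w n ^+ 2 * nsq (phi n)).
  by apply/funext => n; rewrite nsqM nsqC.
have u2 : l2 u by apply/l2P; rewrite uE.
have := below u2; rewrite {1}/sqnorm uE => H.
have /l2P sTu := l2_shifted VM z u2.
(* The commutator of [T] with the weight is the sum of the four terms [e a], each with squared
   modulus at most $4x^2Aw^2$. Nested uses of [nsqD_le] turn them into $64x^2Aw^2$, and separating
   them from $w\psi$ doubles this. *)
have pt n : nsq (shifted V z u n) <=
    2 * (w n ^+ 2 * nsq (psi n)) + 128 * x ^+ 2 * A * w n ^+ 2.
  pose e a := (w (n + a) - w n)%:C * phi (n + a).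
  have -> : shifted V z u n = (w n)%:C * psi n + (e (- (1, 0)) + e (1, 0) +
      (e (- (0, 1)) + e (0, 1))).
    rewrite /e /psi /shifted /schrodinger /laplacian /u !rmorphB /=; ring.
  have ea a : dist0 a = 1%N -> nsq (e a) <= 4 * x ^+ 2 * A * w n ^+ 2.
    move=> a1; rewrite nsqM nsqC -real_normK ?num_real//.
    rewrite (_ : 4 * _ * _ * _ = (2 * x * w n) ^+ 2 * A); last by ring.
    have xw : 0 <= 2 * x * w n by rewrite !mulr_ge0// ltW.
    apply: ler_pM; [exact: sqr_ge0|exact: nsq_ge0| |exact: phi_le].
    by apply: lerXn2r; rewrite ?nnegrE// wstep.
  have e1 := ea (- (1, 0)) erefl; have e2 := ea (1, 0) erefl.
  have e3 := ea (- (0, 1)) erefl; have e4 := ea (0, 1) erefl.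
  have := nsqD_le ((w n)%:C * psi n) (e (- (1, 0)) + e (1, 0) +
      (e (- (0, 1)) + e (0, 1))).
  have := nsqD_le (e (- (1, 0)) + e (1, 0)) (e (- (0, 1)) + e (0, 1)).
  have := nsqD_le (e (- (1, 0))) (e (1, 0)).
  have := nsqD_le (e (- (0, 1))) (e (0, 1)).
  rewrite (nsqM (w n)%:C) nsqC; lra.
have : sqnorm (shifted V z u) <= lsum (fun n =>
    2 * (w n ^+ 2 * nsq (psi n)) + 128 * x ^+ 2 * A * w n ^+ 2).
  apply: le_lsum => //.
  by apply: lsummableD; exact: lsummableZ.
rewrite lsumD; [|exact: lsummableZ|exact: lsummableZ].
rewrite (lsumZ _ s2) (lsumZ _ sw2) -/W => H2.
set S1 := lsum _ in H lo1 hi1; set S2 := lsum _ in H2 lo2 hi2.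
have H3 : c * S1 <= 2 * S2 + 128 * x ^+ 2 * A * W by exact: le_trans H H2.
(* By [xk] the last term is at most $\frac c2 AW$; moving it to the left leaves $\frac c2 AW\le
   8BW$, whence the 16. *)
have H4 : c * (A * W) <= 2 * (4 * (B * W) + 128 * k * x ^+ 2 * (A * W)).
  have h1 := ler_wpM2l (ltW k0) H3; have h2 := ler_wpM2l (ltW c0) lo1.
  lra.
have AW : 0 <= A * W by rewrite mulr_ge0// ltW.
have H5 := ler_wpM2r AW xk.
rewrite -(ler_pM2r W0); lra.
Qed.

End BlochLowerBound.

(** * Roots of unity *)

Section UnitCircle.
Variable R : realType.
Implicit Types (x y : R).

Definition cis_key : unit. Proof. exact: tt. Qed.

(* Locked: failing unifications would otherwise unfold the cosine series. *)
Definition cis : R -> R[i] := locked_with cis_key (fun x => cos x +i* sin x).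

Lemma cisE x : cis x = cos x +i* sin x.
Proof. by rewrite /cis unlock. Qed.

Lemma cisD x y : cis (x + y) = cis x * cis y.
Proof. by rewrite !cisE cosD sinD; congr (_ +i* _); ring. Qed.

Lemma cis0 : cis 0 = 1.
Proof. by rewrite cisE cos0 sin0. Qed.

Lemma cisX x n : cis x ^+ n = cis (n%:R * x).
Proof.
elim: n => [|n IH]; first by rewrite mul0r cis0 expr0.
by rewrite exprS IH -cisD -natr1 mulrDl mul1r addrC.
Qed.

Lemma nsq_cis x : nsq (cis x) = 1.
Proof. by rewrite cisE /nsq /= cos2Dsin2. Qed.

(** The number [cis (2 pi / n)] has some order [m] dividing [n]. If [m < n], a point strictly
    between 0 and $2\pi$ would have cosine 1, which injectivity on $[0,\pi]$ excludes, after the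
    reflection $s\mapsto 2\pi-s$ if $s>\pi$. *)
Lemma prim_root_exists n : (0 < n)%N -> exists z : R[i], n.-primitive_root z.
Proof.
move=> n0; pose t : R := pi *+ 2 / n%:R.
have nR : 0 < n%:R :> R by rewrite ltr0n.
have nt : n%:R * t = pi *+ 2 by rewrite mulrC divfK// gt_eqF.
have : cis t ^+ n = 1 by rewrite cisX nt cisE cos2pi sin2pi.
move=> /(prim_order_exists n0)[m mprim mn].
suff <- : m = n by exists (cis t).
have m0 := prim_order_gt0 mprim.
apply/eqP; rewrite eqn_leq dvdn_leq//= leqNgt; apply/negP => ltmn.
have /(congr1 (@complex.Re R)) := prim_expr_order mprim; rewrite cisX cisE /=.
set s := m%:R * t => cs1.
have pi0 := pi_gt0 R.
have t0 : 0 < t by rewrite divr_gt0// mulrn_wgt0.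
have s0 : 0 < s by rewrite mulr_gt0// ltr0n.
have s2 : s < pi *+ 2 by rewrite -nt ltr_pM2r// ltr_nat.
have pi_in0 : (0 : R) \in `[0, pi] by rewrite in_itv /= lexx ltW.
have [spi|spi] := leP s pi.
  have := @cos_inj R s 0; rewrite cs1 cos0 => /(_ _ pi_in0 erefl).
  by rewrite in_itv /= spi ltW// => /(_ isT) s00; rewrite s00 ltxx in s0.
have := @cos_inj R (pi *+ 2 - s) 0.
rewrite cosB cos2pi sin2pi mul0r addr0 mul1r cs1 cos0 => /(_ _ pi_in0 erefl).
rewrite in_itv /= subr_ge0 ltW// lerBlDr mulr2n lerD2l ltW// => /(_ isT).
by move=> /eqP; rewrite subr_eq0 => /eqP E; rewrite mulr2n E ltxx in s2.
Qed.

Lemma cos_sin_lipschitz x y :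
  `|cos x - cos y| <= `|x - y| /\ `|sin x - sin y| <= `|x - y|.
Proof.
wlog xy : x y / y <= x.
  move=> H; have [/H//|/ltW/H[h1 h2]] := leP y x.
  by rewrite distrC [`|sin x - _|]distrC [`|x - y|]distrC.
have cc : {within `[y, x], continuous (@cos R)}.
  by apply: continuous_subspaceT => z; exact: continuous_cos.
have cs : {within `[y, x], continuous (@sin R)}.
  by apply: continuous_subspaceT => z; exact: continuous_sin.
have [c _ ->] := MVT_segment xy (fun z _ => is_derive_cos z) cc.
have [d _ ->] := MVT_segment xy (fun z _ => is_derive_sin z) cs.
by split; rewrite normrM ler_piMl// ?normrN ?sin_max ?cos_max.
Qed.

Lemma nsq1_inv (z : R[i]) : nsq z = 1 -> z^* = z^-1.
Proof.
move=> z1; have zJ : z * z^* = 1.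
  case: z z1 => a b; rewrite /nsq /= => z1; apply/eqP; rewrite eq_complex /=.
  by apply/andP; split; apply/eqP; [rewrite -z1|]; ring.
have z0 : z != 0.
  by apply: contra_eq_neq zJ => ->; rewrite mul0r eq_sym oner_eq0.
by apply: (mulfI z0); rewrite zJ divff.
Qed.

Lemma nsq1_neq0 (z : R[i]) : nsq z = 1 -> z != 0.
Proof.
by move=> z1; apply/eqP => z0; move: z1; rewrite z0 /nsq /= expr0n addr0 =>
  /eqP; rewrite eq_sym oner_eq0.
Qed.

Lemma nsqX (z : R[i]) n : nsq (z ^+ n) = nsq z ^+ n.
Proof.
elim: n => [|n IH]; last by rewrite !exprS nsqM IH.
by rewrite !expr0 /nsq /= expr1n expr0n addr0.
Qed.

Lemma nsqXz (z : R[i]) (n : int) : nsq z = 1 -> nsq (z ^ n) = 1.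
Proof.
move=> z1; case: n => n; first by rewrite -exprnP nsqX z1 expr1n.
by rewrite NegzE -exprnN -nsq1_inv ?nsqJ nsqX z1 expr1n.
Qed.

Lemma nsq_prim_root (z : R[i]) n : n.-primitive_root z -> nsq z = 1.
Proof.
move=> zn; have n0 := prim_order_gt0 zn.
have := prim_expr_order zn => /(congr1 (@nsq R)); rewrite nsqX.
rewrite {2}/nsq /= expr1n expr0n addr0 => /eqP.
by rewrite pexpr_eq1 ?nsq_ge0// => /eqP.
Qed.

Lemma prim_root_orth n (z : R[i]) (i j : 'I_n) : n.-primitive_root z ->
  \sum_(k < n) z ^+ (i * k) * (z ^+ (j * k))^* = if i == j then n%:R else 0.
Proof.
move=> zn; have z1 := nsq_prim_root zn; have z0 := nsq1_neq0 z1.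
have E (k : 'I_n) : z ^+ (i * k) * (z ^+ (j * k))^* = (z ^+ i / z ^+ j) ^+ k.
  have zjk : nsq (z ^+ (j * k)) = 1 by rewrite nsqX z1 expr1n.
  by rewrite (nsq1_inv zjk) expr_div_n !exprM.
under eq_bigr do rewrite E.
have [->|ij] := eqVneq i j.
  rewrite divff ?expf_neq0//; under eq_bigr do rewrite expr1n.
  by rewrite sumr_const card_ord.
set w := z ^+ i / z ^+ j.
have wn : w ^+ n = 1.
  by rewrite expr_div_n -!exprM ![(_ * n)%N]mulnC !exprM (prim_expr_order zn)
    !expr1n divr1.
have w1 : w - 1 != 0.
  rewrite subr_eq0; apply/eqP => w1; move/eqP: ij; apply; apply: val_inj => /=.
  have : z ^+ i = z ^+ j.
    by rewrite -[LHS](divfK (expf_neq0 j z0)) -/w w1 mul1r.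
  by move=> /eqP; rewrite (eq_prim_root_expr zn) !modn_small// => /eqP.
have /eqP : (w - 1) * \sum_(k < n) w ^+ k = 0 by rewrite -subrX1 wn subrr.
by rewrite mulf_eq0 (negPf w1) => /eqP.
Qed.

End UnitCircle.

(** * Floquet matrices *)

Section Periodic.
Variables p q : nat.
Hypotheses (p0 : (0 < p)%N) (q0 : (0 < q)%N).

Notation K := ('I_p * 'I_q)%type.

Definition periodic2 (T : Type) (f : lattice -> T) : Prop := forall n1 n2 : int,
  f (n1 + p%:Z, n2) = f (n1, n2) /\ f (n1, n2 + q%:Z) = f (n1, n2).

Definition cell (k : K) : lattice := ((k.1 : nat)%:Z, (k.2 : nat)%:Z).

Let shift_int (T : Type) (g : int -> T) (m : int) :
  (forall n, g (n + m) = g n) -> forall j n, g (n + j * m) = g n.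
Proof.
move=> gm j; elim: j => [|j IH|j IH] n.
- by rewrite mul0r addr0.
- by rewrite -addn1 PoszD mulrDl mul1r addrA gm IH.
- by rewrite -[RHS]IH -addn1 PoszD opprD mulrDl mulN1r -[LHS]gm addrA subrK.
Qed.

(** The representative is chosen before [f], so several periodic functions can be moved to the same
    cell point. *)
Lemma cell_rep (n : lattice) : exists k : K,
  forall (T : Type) (f : lattice -> T), periodic2 f -> f n = f (cell k).
Proof.
case: n => n1 n2.
have modz_ord (m : nat) (x : int) : (0 < m)%N -> exists i : 'I_m,
    x = (i : nat)%:Z + (x %/ m%:Z)%Z * m%:Z.
  move=> m0; have m0' : m%:Z != 0 by lia.
  have := ltz_mod x m0'; have := modz_ge0 x m0'.
  case E : (x %% m%:Z)%Z => [j|//] _; move=> jlt; have jm : (j < m)%N by lia.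
  by exists (Ordinal jm); rewrite {1}(divz_eq x m%:Z) E addrC.
have [i1 E1] := modz_ord p n1 p0; have [i2 E2] := modz_ord q n2 q0.
exists (i1, i2) => T f fper; rewrite /cell /= {1}E1 {1}E2.
rewrite (shift_int (g := fun x => f (x, _))); last first.
  by move=> x; have [-> _] := fper x (i2%:Z + (n2 %/ q)%Z * q).
by rewrite (shift_int (g := fun x => f (_, x)))// => x; have [_ ->] := fper i1 x.
Qed.

Lemma cell_eq (T : Type) (f g : lattice -> T) : periodic2 f -> periodic2 g ->
  (forall k, f (cell k) = g (cell k)) -> f =1 g.
Proof.
by move=> fp gp fg n; have [k kE] := cell_rep n; rewrite (kE _ f)// (kE _ g).
Qed.

Lemma periodic2_comp (T S : Type) (F : T -> S) (f : lattice -> T) :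
  periodic2 f -> periodic2 (F \o f).
Proof. by move=> fp n1 n2; have [h1 h2] := fp n1 n2; rewrite /= h1 h2. Qed.

Lemma periodic2_map2 (T S U : Type) (F : T -> S -> U) (f : lattice -> T)
    (g : lattice -> S) : periodic2 f -> periodic2 g ->
  periodic2 (fun n => F (f n) (g n)).
Proof.
move=> fp gp n1 n2; have [h1 h2] := fp n1 n2; have [h3 h4] := gp n1 n2.
by rewrite h1 h2 h3 h4.
Qed.

Variable R : realType.
Variables z1 z2 : R[i].
Hypotheses (z1p : p.-primitive_root z1) (z2q : q.-primitive_root z2).

Let N : nat := #|{: K}|.

Let NE : N%:R = p%:R * q%:R :> R[i].
Proof. by rewrite /N card_prod !card_ord natrM. Qed.

(** A character of $\mathbb{Z}^2$, periodic when [s = t = 0]; integer powers make it total on the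
    lattice and [z1], [z2] may be any primitive roots. *)
Definition chi (s t : R) (k : K) (n : lattice) : R[i] :=
  (cis s * z1 ^+ k.1) ^ n.1 * (cis t * z2 ^+ k.2) ^ n.2.

Let ch (k h : K) : R[i] := z1 ^+ (k.1 * h.1) * z2 ^+ (k.2 * h.2).

Let chC k h : ch k h = ch h k.
Proof. by rewrite /ch ![(k.1 * _)%N]mulnC ![(k.2 * _)%N]mulnC. Qed.

Let ch_orth k k' : \sum_h ch k h * (ch k' h)^* = if k == k' then N%:R else 0.
Proof.
have -> : \sum_h ch k h * (ch k' h)^* =
    (\sum_(i < p) z1 ^+ (k.1 * i) * (z1 ^+ (k'.1 * i))^*) *
    (\sum_(j < q) z2 ^+ (k.2 * j) * (z2 ^+ (k'.2 * j))^*).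
  rewrite mulr_suml.
  under [RHS]eq_bigr do rewrite mulr_sumr.
  rewrite pair_bigA /=; apply: eq_bigr => -[i j] _ /=.
  by rewrite /ch rmorphM /=; ring.
rewrite !prim_root_orth// NE -pair_eqE /pair_eq /=.
by case: eqP => _; case: eqP => _; rewrite /= ?mul0r ?mulr0.
Qed.

Let w1n (s : R) (k : 'I_p) : nsq (cis s * z1 ^+ k) = 1.
Proof. by rewrite nsqM nsq_cis nsqX (nsq_prim_root z1p) expr1n mulr1. Qed.

Let w2n (s : R) (k : 'I_q) : nsq (cis s * z2 ^+ k) = 1.
Proof. by rewrite nsqM nsq_cis nsqX (nsq_prim_root z2q) expr1n mulr1. Qed.

Lemma nsq_chi s t k n : nsq (chi s t k n) = 1.
Proof. by rewrite nsqM (nsqXz _ (w1n _ _)) (nsqXz _ (w2n _ _)) mulr1. Qed.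

Lemma chiD s t k (n m : lattice) :
  chi s t k (n + m) = chi s t k n * chi s t k m.
Proof.
rewrite /chi (expfzDr _ _ (nsq1_neq0 (w1n s k.1))).
by rewrite (expfzDr _ _ (nsq1_neq0 (w2n t k.2))) mulrACA.
Qed.

Lemma chi_twist s t k n : chi s t k n = (cis s ^ n.1 * cis t ^ n.2) * chi 0 0 k n.
Proof.
by rewrite /chi cis0 !mul1r (expfzMl (cis s)) (expfzMl (cis t)) mulrACA.
Qed.

Lemma periodic_chi k : periodic2 (chi 0 0 k).
Proof.
move=> n1 n2; rewrite /chi cis0 !mul1r /=; split.
  rewrite expfzDr ?nsq1_neq0 ?nsqX ?(nsq_prim_root z1p) ?expr1n//.
  by rewrite -exprnP -exprM mulnC exprM (prim_expr_order z1p) expr1n mulr1.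
rewrite expfzDr ?nsq1_neq0 ?nsqX ?(nsq_prim_root z2q) ?expr1n//.
by rewrite -exprnP -exprM mulnC exprM (prim_expr_order z2q) expr1n mulr1.
Qed.

Let chi_cell k h : chi 0 0 k (cell h) = ch k h.
Proof. by rewrite /chi cis0 !mul1r /= -!exprnP -!exprM. Qed.

Definition bloch (s t : R) (a : K -> R[i]) (n : lattice) : R[i] :=
  \sum_k a k * chi s t k n.

Definition fourier (f : lattice -> R[i]) (k : K) : R[i] :=
  N%:R^-1 * \sum_h f (cell h) * (chi 0 0 k (cell h))^*.

Let N0 : N%:R != 0 :> R[i].
Proof. by rewrite NE mulf_neq0// pnatr_eq0 -lt0n. Qed.

Lemma periodic_bloch a : periodic2 (bloch 0 0 a).
Proof.
move=> n1 n2; split; apply: eq_bigr => k _; congr (_ * _).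
  by case: (periodic_chi k n1 n2).
by case: (periodic_chi k n1 n2).
Qed.

Lemma fourier_inversion f : periodic2 f -> f =1 bloch 0 0 (fourier f).
Proof.
move=> fp; apply: cell_eq => // [|h']; first exact: periodic_bloch.
rewrite /bloch /fourier.
under eq_bigr do rewrite -mulrA mulr_suml.
rewrite -mulr_sumr exchange_big /=.
transitivity (N%:R^-1 * \sum_h f (cell h) * (if h' == h then N%:R else 0)).
  rewrite (bigD1 h')//= eqxx big1 ?addr0; last first.
    by move=> h; rewrite eq_sym => /negPf ->; rewrite mulr0.
  by rewrite mulrC mulfK.
(* Since [ch] is symmetric in its arguments, orthogonality of characters doubles as orthogonality of
   cell points. *)
congr (_ * _); apply: eq_bigr => h _; rewrite -ch_orth mulr_sumr.
by apply: eq_bigr => k _; rewrite !chi_cell (chC h') (chC h); ring.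
Qed.

Lemma rdotE (x y : R[i]) : rdot x y = complex.Re (x * y^*).
Proof. by case: x y => [a b] [c d]; rewrite /rdot /=; ring. Qed.

Lemma Re_sum (I : finType) (F : I -> R[i]) :
  complex.Re (\sum_i F i) = \sum_i complex.Re (F i).
Proof. by apply: (big_morph (@complex.Re R)) => // -[? ?] [? ?]. Qed.

(** The twist by [cis s] and [cis t] is a unimodular factor independent of [k], so it cancels and
    orthogonality of the periodic characters remains. The free base point [n] is what
    [bloch_bounded_below] asks for. *)
Lemma bloch_parseval s t a b (n : lattice) :
  \sum_h rdot (bloch s t a (n + cell h)) (bloch s t b (n + cell h)) =
  N%:R * \sum_k rdot (a k) (b k).
Proof.
have E (x y : K -> R[i]) : \sum_k rdot (x k) (y k) = complex.Re (\sum_k x k * (y k)^*).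
  by rewrite Re_sum; apply: eq_bigr => k _; rewrite rdotE.
rewrite !E.
have [e e1 eE] : exists2 e : lattice -> R[i], forall h, nsq (e h) = 1 &
    forall k h, chi s t k h = e h * chi 0 0 k h.
  exists (fun h => cis s ^ h.1 * cis t ^ h.2) => [h|k h]; last exact: chi_twist.
  have h1 : nsq (cis s ^ h.1) = 1 by exact: nsqXz (nsq_cis s).
  have h2 : nsq (cis t ^ h.2) = 1 by exact: nsqXz (nsq_cis t).
  by rewrite nsqM h1 h2 mulr1.
have eJ h : e h * (e h)^* = 1.
  by rewrite (nsq1_inv (e1 h)) divff//; exact: nsq1_neq0.
have expand x h : bloch s t x (n + cell h) =
    e (cell h) * \sum_k (x k * chi s t k n) * ch k h.
  rewrite /bloch mulr_sumr; apply: eq_bigr => k _.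
  rewrite chiD (eE k (cell h)) chi_cell.
  by move: (chi s t k n) (e (cell h)) (ch k h) => u v w; ring.
have -> : \sum_h bloch s t a (n + cell h) * (bloch s t b (n + cell h))^* =
    N%:R * \sum_k a k * (b k)^*.
  transitivity (\sum_h \sum_k \sum_k' (a k * chi s t k n) *
      (b k' * chi s t k' n)^* * (ch k h * (ch k' h)^*)).
    apply: eq_bigr => h _; rewrite !expand rmorphM /= mulrACA eJ mul1r.
    rewrite rmorph_sum mulr_suml; apply: eq_bigr => k _.
    rewrite mulr_sumr; apply: eq_bigr => k' _.
    by rewrite rmorphM /=; ring.
  rewrite exchange_big mulr_sumr; apply: eq_bigr => k _.
  rewrite exchange_big /= (bigD1 k)//= [X in _ + X]big1 ?addr0; last first.
    move=> k' k'k; rewrite -mulr_sumr ch_orth eq_sym (negPf k'k).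
    by rewrite mulr0.
  rewrite -mulr_sumr ch_orth eqxx rmorphM /=.
  have cJ : chi s t k n * (chi s t k n)^* = 1.
    have c1 := nsq_chi s t k n.
    by rewrite (nsq1_inv c1) divff// nsq1_neq0.
  rewrite mulrACA cJ; ring.
rewrite (_ : N%:R = (N%:R : R)%:C); last by rewrite rmorph_nat.
by case: (\sum_k _) => x y /=; ring.
Qed.

Variable V : lattice -> R.
Hypothesis Vper : periodic2 V.

Definition symbol (s t : R) (k : K) : R :=
  2 * complex.Re (cis s * z1 ^+ k.1) + 2 * complex.Re (cis t * z2 ^+ k.2).

(** The matrix of multiplication by [V] in the basis of characters. Expanding [V] times a character,
    rather than [V], avoids index arithmetic modulo [p] and [q]. *)
Definition Vhat (k k' : K) : R[i] := fourier (fun n => (V n)%:C * chi 0 0 k' n) k.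

Definition potential (a : K -> R[i]) (k : K) : R[i] := \sum_k' Vhat k k' * a k'.

Definition floquet (s t : R) (a : K -> R[i]) (k : K) : R[i] :=
  (symbol s t k)%:C * a k + potential a k.

Lemma bloch_potential s t a n :
  (V n)%:C * bloch s t a n = bloch s t (potential a) n.
Proof.
transitivity (\sum_k \sum_k' Vhat k' k * a k * chi s t k' n); last first.
  rewrite exchange_big; apply: eq_bigr => k _ /=.
  by rewrite /potential mulr_suml.
rewrite /bloch mulr_sumr; apply: eq_bigr => k _.
have fp : periodic2 (fun n => (V n)%:C * chi 0 0 k n).
  apply: (periodic2_map2 (fun (x : R) y => x%:C * y)) => //.
  exact: periodic_chi.
have := fourier_inversion fp n; rewrite /bloch => E.
rewrite chi_twist mulrCA [_%:C * (_ * _)]mulrCA E !mulr_sumr.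
apply: eq_bigr => k' _; rewrite (chi_twist s t k') /Vhat.
move: (chi 0 0 k' n) (fourier _ _) (a k) (cis s ^ n.1) (cis t ^ n.2).
by move=> x y z w v; ring.
Qed.

Lemma laplacian_bloch s t a n :
  laplacian (bloch s t a) n = bloch s t (fun k => (symbol s t k)%:C * a k) n.
Proof.
rewrite /laplacian /bloch -!big_split /=; apply: eq_bigr => k _.
rewrite !chiD.
have inv2 (w : R[i]) : nsq w = 1 -> w^-1 + w = (2 * complex.Re w)%:C.
  move=> wn; rewrite -(nsq1_inv wn); case: w {wn} => x y.
  by apply/eqP; rewrite eq_complex /=; apply/andP; split; apply/eqP; ring.
have c1 : chi s t k (- (1, 0)) + chi s t k (1, 0) =
    (2 * complex.Re (cis s * z1 ^+ k.1))%:C.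
  by rewrite /chi /= oppr0 !expr0z !mulr1 expr1z exprN1 inv2.
have c2 : chi s t k (- (0, 1)) + chi s t k (0, 1) =
    (2 * complex.Re (cis t * z2 ^+ k.2))%:C.
  by rewrite /chi /= oppr0 !expr0z !mul1r expr1z exprN1 inv2.
rewrite /symbol rmorphD /= -c1 -c2; move: (chi s t k n) (a k).
move: (chi s t k (1, 0)) (chi s t k (0, 1)).
move: (chi s t k (- (1, 0))) (chi s t k (- (0, 1))) => x y x' y' w b.
ring.
Qed.

Lemma schrodinger_bloch s t a n :
  schrodinger V (bloch s t a) n = bloch s t (floquet s t a) n.
Proof.
rewrite /schrodinger laplacian_bloch bloch_potential /bloch -big_split /=.
by apply: eq_bigr => k _; rewrite -mulrDl.
Qed.

Lemma VhatJ k k' : (Vhat k k')^* = Vhat k' k.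
Proof.
rewrite /Vhat /fourier rmorphM /= fmorphV rmorph_nat rmorph_sum; congr (_ * _).
apply: eq_bigr => h _; move: (chi 0 0 k _) (chi 0 0 k' _) => x y.
rewrite !rmorphM /= conjCK.
have -> : ((V (cell h))%:C)^* = (V (cell h))%:C :> R[i] by exact: conjc_real.
by rewrite mulrAC.
Qed.

Lemma floquet_sym s t a b :
  \sum_k rdot (floquet s t a k) (b k) = \sum_k rdot (a k) (floquet s t b k).
Proof.
have rdot_sumr (x : R[i]) (F : K -> R[i]) : rdot x (\sum_k F k) = \sum_k rdot x (F k).
  apply: (big_morph (rdot x)); last by rewrite /rdot /=; ring.
  by move=> u v; rewrite rdotC rdotDl ![rdot x _]rdotC.
have H : \sum_k rdot (potential a k) (b k) = \sum_k rdot (a k) (potential b k).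
  rewrite /potential; under eq_bigr do rewrite rdotC rdot_sumr.
  rewrite exchange_big; apply: eq_bigr => k _; rewrite rdot_sumr.
  by apply: eq_bigr => k' _; rewrite rdotC rdotMl VhatJ.
have E x y : \sum_k rdot (floquet s t x k) (y k) =
    \sum_k symbol s t k * rdot (x k) (y k) + \sum_k rdot (potential x k) (y k).
  by rewrite -big_split; apply: eq_bigr => k _; rewrite rdotDl rdotZl.
rewrite E H; under [RHS]eq_bigr do rewrite rdotC.
rewrite E; congr (_ + _); apply: eq_bigr => k _; first by rewrite rdotC.
exact: rdotC.
Qed.

(** By [bloch_parseval] the form is an average of $V|f|^2$ over the cell, with $f$ the periodic
    Bloch function of [a]. The bound therefore does not grow with the size of the matrix. *)
Lemma potential_form (d : R) a : (forall n, `|V n| <= d) ->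
  `|\sum_k rdot (potential a k) (a k)| <= d * \sum_k nsq (a k).
Proof.
move=> Vd; have NR : 0 < N%:R :> R.
  rewrite ltr0n lt0n; apply/eqP => N00; move: N0; rewrite N00 mulr0n eqxx.
  by [].
have pars b := bloch_parseval 0 0 b a 0.
rewrite -(ler_pM2l NR) -[in leLHS](ger0_norm (ltW NR)) -normrM -pars.
have -> : N%:R * (d * \sum_k nsq (a k)) =
    d * \sum_h rdot (bloch 0 0 a (0 + cell h)) (bloch 0 0 a (0 + cell h)).
  by rewrite pars mulrCA; congr (_ * (_ * _)).
rewrite (le_trans (ler_norm_sum _ _ _))// mulr_sumr; apply: ler_sum => h _.
rewrite -bloch_potential rdotZl normrM rdotxx (ger0_norm (nsq_ge0 _)).
by rewrite ler_wpM2r ?nsq_ge0.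
Qed.

End Periodic.

(** * Lipschitz dependence of determinants on their entries *)

Section Determinant.
Variable F : numDomainType.

(** The factors are exchanged one at a time; [1 <= M] lets the single power [M ^+ size r] dominate
    every partial product. *)
Lemma prod_lipschitz (I : Type) (r : seq I) (x y : I -> F) (M d : F) :
  1 <= M -> (forall i, `|x i| <= M) -> (forall i, `|y i| <= M) ->
  (forall i, `|x i - y i| <= d) ->
  `|\prod_(i <- r) x i - \prod_(i <- r) y i| <=
    (size r)%:R * M ^+ size r * d.
Proof.
move=> M1 xM yM xyd; have M0 : 0 <= M by rewrite (le_trans ler01).
elim: r => [|i r IH]; first by rewrite !big_nil subrr normr0 !mul0r.
have prodM (z : I -> F) : (forall i, `|z i| <= M) ->
    `|\prod_(i <- r) z i| <= M ^+ size r.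
  move=> zM; elim: r {IH} => [|j r IH]; first by rewrite big_nil normr1.
  by rewrite big_cons normrM exprS ler_pM.
rewrite !big_cons /=.
have -> : x i * \prod_(j <- r) x j - y i * \prod_(j <- r) y j =
  (x i - y i) * \prod_(j <- r) x j +
  y i * (\prod_(j <- r) x j - \prod_(j <- r) y j) by ring.
apply: le_trans (ler_normD _ _) _; rewrite !normrM.
have d0 : 0 <= d by exact: le_trans (normr_ge0 _) (xyd i).
have h1 : `|x i - y i| * `|\prod_(j <- r) x j| <= d * (M * M ^+ size r).
  apply: ler_pM => //; rewrite (le_trans (prodM _ xM))//.
  by rewrite ler_peMl// exprn_ge0.
have h2 : `|y i| * `|\prod_(j <- r) x j - \prod_(j <- r) y j| <=
  M * ((size r)%:R * M ^+ size r * d) by apply: ler_pM.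
apply: le_trans (lerD h1 h2) _.
by rewrite exprS -natr1 le_eqVlt; apply/orP; left; apply/eqP; ring.
Qed.

Lemma det_lipschitz n (A B : 'M[F]_n) (M d : F) : 1 <= M ->
  (forall i j, `|A i j| <= M) -> (forall i j, `|B i j| <= M) ->
  (forall i j, `|A i j - B i j| <= d) ->
  `|\det A - \det B| <= #|{perm 'I_n}|%:R * (n%:R * M ^+ n * d).
Proof.
move=> M1 AM BM ABd; rewrite /determinant -sumrB.
apply: le_trans (ler_norm_sum _ _ _) _.
rewrite mulr_natl -sumr_const; apply: ler_sum => s _.
rewrite -mulrBr normrM normrX normrN1 expr1n mul1r.
have := @prod_lipschitz _ (enum 'I_n) (fun i => A i (s i))
  (fun i => B i (s i)) M d M1.
by rewrite !big_enum /= size_enum_ord; apply.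
Qed.

End Determinant.

(** * From lower bounds on the lattice to Floquet matrices *)

Section FloquetMatrix.
Variables (R : realType) (p q : nat).
Hypotheses (p0 : (0 < p)%N) (q0 : (0 < q)%N).
Variables z1 z2 : R[i].
Hypotheses (z1p : p.-primitive_root z1) (z2q : q.-primitive_root z2).

Notation K := ('I_p * 'I_q)%type.

Section Potential.
Variable V : lattice -> R.
Hypothesis Vper : periodic2 p q V.

(** By Parseval a Bloch wave and its image under [T - E] have constant sums of squares over all
    translates of the cell, as [bloch_bounded_below] requires. Its constant knows nothing of the
    wave, so it is uniform in [s] and [t]. *)
Lemma floquet_bounded_below (M E : R) : (forall n, `|V n| <= M) ->
  ~ spectrum (schrodinger V) E%:C ->
  exists2 c : R, 0 < c & forall s t (a : K -> R[i]),
    c * \sum_k nsq (a k) <=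
    \sum_k nsq (floquet z1 z2 V s t a k - E%:C * a k).
Proof.
move=> VM /(bounded_below_spectrum VM)[c c0 below].
exists (c / 16); first by rewrite divr_gt0.
move=> s t a; pose b k := floquet z1 z2 V s t a k - E%:C * a k.
have NR : 0 < #|{: K}|%:R :> R.
  by rewrite ltr0n card_prod !card_ord muln_gt0 p0.
have pars (x : K -> R[i]) (n : lattice) :
    \sum_(h : K) nsq (bloch z1 z2 s t x (n + cell h)) =
    #|{: K}|%:R * \sum_k nsq (x k).
  have nsqE (I : finType) (f : I -> R[i]) :
      \sum_i nsq (f i) = \sum_i rdot (f i) (f i).
    by apply: eq_bigr => i _; rewrite rdotxx.
  rewrite (nsqE _ (fun h : K => bloch z1 z2 s t x (n + cell h))) (nsqE _ x).
  exact: (bloch_parseval z1p z2q s t x x n).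
have shiftE n : shifted V E%:C (bloch z1 z2 s t a) n = bloch z1 z2 s t b n.
  rewrite /shifted (schrodinger_bloch p0 q0 z1p z2q Vper) /bloch mulr_sumr -sumrB.
  by apply: eq_bigr => k _; rewrite mulrA -mulrBl.
have dcell (h : K) : (dist0 (cell h) <= p + q)%N.
  by rewrite /dist0 /= leq_add// ltnW.
have cell0 : cell (Ordinal p0, Ordinal q0) = 0 by [].
have := bloch_bounded_below VM cell0 dcell c0 below (pars a).
move=> /(_ (#|{: K}|%:R * \sum_k nsq (b k))) H.
rewrite -(ler_pM2l NR) mulrCA; apply: H => n.
by rewrite -(pars b n); apply: eq_bigr => h _; rewrite shiftE.
Qed.

(** The transpose of the matrix of [floquet] minus [E], since [det0P] provides row vectors. *)
Definition floquet_mx (s t E : R) : 'M[R[i]]_#|{: K}| :=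
  \matrix_(i, j) ((i == j)%:R * (symbol z1 z2 s t (enum_val j) - E)%:C +
    Vhat z1 z2 V (enum_val j) (enum_val i)).

Lemma floquet_mx_mul s t E (v : 'rV[R[i]]_#|{: K}|) k :
  (v *m floquet_mx s t E) 0 (enum_rank k) =
  floquet z1 z2 V s t (fun k => v 0 (enum_rank k)) k - E%:C * v 0 (enum_rank k).
Proof.
rewrite mxE /floquet /potential.
under eq_bigr do rewrite mxE mulrDr.
rewrite big_split /= (bigD1 (enum_rank k))//= big1 ?addr0; last first.
  by move=> i /negPf ->; rewrite mul0r mulr0.
rewrite eqxx enum_rankK mul1r rmorphB /=.
rewrite (reindex (@enum_rank {: K})) /=; last first.
  by exists enum_val => i _; rewrite ?enum_rankK ?enum_valK.
have -> : \sum_j v 0 (enum_rank j) * Vhat z1 z2 V k (enum_val (enum_rank j)) =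
    \sum_k' Vhat z1 z2 V k k' * v 0 (enum_rank k').
  by apply: eq_bigr => j _; rewrite enum_rankK mulrC.
ring.
Qed.

Lemma floquet_mx_det0 s t E : \det (floquet_mx s t E) = 0 ->
  exists2 a : K -> R[i], 0 < \sum_k nsq (a k) &
    forall k, floquet z1 z2 V s t a k - E%:C * a k = 0.
Proof.
move=> /eqP/det0P[v v0 vA]; exists (fun k => v 0 (enum_rank k)).
  have S0 : 0 <= \sum_k nsq (v 0 (@enum_rank {: K} k)).
    by apply: sumr_ge0 => k _; exact: nsq_ge0.
  rewrite lt_neqAle S0 andbT eq_sym; apply: contra v0.
  rewrite psumr_eq0 => [/allP H|k _]; last exact: nsq_ge0.
  apply/eqP/rowP => j; rewrite mxE -[j]enum_valK; apply: nsq_eq0.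
  by apply/eqP; apply: H; rewrite mem_index_enum.
by move=> k; rewrite -floquet_mx_mul vA mxE.
Qed.

(** The matrix is Hermitian, so conjugating it amounts to transposing it. Reality opens the
    determinant to the intermediate value theorem. *)
Lemma floquet_mx_det_real s t E : complex.Im (\det (floquet_mx s t E)) = 0.
Proof.
have conj_det : (\det (floquet_mx s t E))^* = \det (floquet_mx s t E).
  rewrite -det_map_mx -[RHS]det_tr; congr (\det _); apply/matrixP => i j.
  rewrite !mxE rmorphD rmorphM /= rmorph_nat VhatJ; congr (_ + _).
  have [->|_] := eqVneq i j; last by rewrite !mul0r.
  by congr (_ * _); exact: conjc_real.
move: conj_det; case: (\det _) => x y /(congr1 (@complex.Im R)) /=; lra.
Qed.

Lemma floquet_solve E (b : K -> R[i]) (c : R) : 0 < c ->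
  (forall a : K -> R[i], c * \sum_k nsq (a k) <=
    \sum_k nsq (floquet z1 z2 V 0 0 a k - E%:C * a k)) ->
  exists a : K -> R[i], forall k, floquet z1 z2 V 0 0 a k - E%:C * a k = b k.
Proof.
move=> c0 below.
have D0 : \det (floquet_mx 0 0 E) != 0.
  apply/eqP => /floquet_mx_det0[a a0 aE].
  have := below a; rewrite [leRHS]big1 => [|k _].
    by rewrite leNgt mulr_gt0.
  by rewrite aE /nsq /= expr0n addr0.
have U : floquet_mx 0 0 E \in unitmx by rewrite unitmxE unitfE.
pose v := (\row_i b (enum_val i)) *m invmx (floquet_mx 0 0 E).
exists (fun k => v 0 (enum_rank k)) => k.
by rewrite -floquet_mx_mul /v mulmxKV// mxE enum_rankK.
Qed.

End Potential.
End FloquetMatrix.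

(** * The interior of the free spectrum *)

Section LevelCurve.
Variable R : realType.

Lemma poly_nonroot (P : {poly R}) (a b : R) : P != 0 -> a < b ->
  exists x, a < x < b /\ P.[x] != 0.
Proof.
move=> P0 ab; apply: contrapT => H.
(* The points with index at most [n] lie strictly inside the interval, and already [size P] of them
   are too many to be roots. *)
pose n := size P; pose pt (i : nat) := a + (b - a) * (i.+1%:R / n.+2%:R).
have n0 : 0 < n.+2%:R :> R by rewrite ltr0n.
have ba : 0 < b - a by rewrite subr_gt0.
have ptP i : (i < n.+1)%N -> a < pt i < b.
  move=> ilt; rewrite /pt ltrDl mulr_gt0 ?divr_gt0 ?ltr0n//=.
  rewrite -ltrBrDl gtr_pMr// ltr_pdivrMr// mul1r ltr_nat.
  by rewrite ltnS.
have pt_inj : injective pt.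
  move=> i j /addrI /(mulfI (lt0r_neq0 ba)).
  move=> /(mulIf (invr_neq0 (lt0r_neq0 n0))) /eqP.
  by rewrite eqr_nat => /eqP[].
have rootP : all (root P) [seq pt i | i <- iota 0 n].
  apply/allP => _ /mapP[i + ->]; rewrite mem_iota add0n => /= ilt.
  apply: contrapT => nr; apply: H; exists (pt i); split; last exact/negP.
  by apply: ptP; rewrite ltnW.
have := max_poly_roots P0 rootP; rewrite map_inj_uniq// iota_uniq => /(_ isT).
by rewrite size_map size_iota ltnn.
Qed.

(* With [X = cos x] and [cos x + cos y = e], eliminating both sines from
   [cos x + cos y = A cos x - B sin x + C cos y - D sin y] gives a quartic
   equation for [X]. *)
Definition coincidence_poly (A B C D e : R) : {poly R} :=
  let S2 := 1 - 'X ^+ 2 in let Z2 := 1 - (e%:P - 'X) ^+ 2 in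
  ((e%:P - A *: 'X - C *: (e%:P - 'X)) ^+ 2 - B ^+ 2 *: S2 - D ^+ 2 *: Z2) ^+ 2
  - (4 * B ^+ 2 * D ^+ 2) *: (S2 * Z2).

Lemma coincidence_polyP (A B C D e X S Y Z : R) :
  X ^+ 2 + S ^+ 2 = 1 -> Y ^+ 2 + Z ^+ 2 = 1 -> X + Y = e ->
  (A * X - B * S) + (C * Y - D * Z) = e -> (coincidence_poly A B C D e).[X] = 0.
Proof.
move=> XS YZ XY co; rewrite /coincidence_poly !hornerE /=.
have <- : Y = e - X by rewrite -XY; ring.
have -> : 1 - X ^+ 2 = S ^+ 2 by rewrite -XS; ring.
have -> : 1 - Y ^+ 2 = Z ^+ 2 by rewrite -YZ; ring.
have -> : e - A * X - C * Y = - (B * S + D * Z) by rewrite -co; ring.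
ring.
Qed.

(** With $w_1=A+iB$ and $w_2=C+iD$ the hypotheses read $w_1\ne w_2$ and $w_1\ne\overline{w_2}$; the
    product of the two quantities is the leading coefficient. *)
Lemma coincidence_poly_neq0 (A B C D e : R) :
  (A - C) ^+ 2 + (B - D) ^+ 2 != 0 -> (A - C) ^+ 2 + (B + D) ^+ 2 != 0 ->
  coincidence_poly A B C D e != 0.
Proof.
move=> h1 h2; apply/eqP => P0.
pose f x := (coincidence_poly A B C D e).[x].
have : f 0 - 4 * f 1 + 6 * f 2 - 4 * f 3 + f 4 = 0.
  by rewrite /f P0 !horner0; ring.
(* The fourth difference of a quartic is 24 times its leading coefficient. *)
have -> : f 0 - 4 * f 1 + 6 * f 2 - 4 * f 3 + f 4 =
    24 * (((A - C) ^+ 2 + (B - D) ^+ 2) * ((A - C) ^+ 2 + (B + D) ^+ 2)).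
  by rewrite /f /coincidence_poly !hornerE /=; ring.
by apply/eqP; rewrite !mulf_neq0// pnatr_eq0.
Qed.

Lemma generic_level_point (I : finType) (w1 w2 : I -> R[i]) (E : R) :
  (forall i, w1 i != w2 i) -> (forall i, w1 i != (w2 i)^*) -> -4 < E < 4 ->
  exists x y, [/\ 0 < x < pi, 2 * cos x + 2 * cos y = E &
    forall i, 2 * complex.Re (cis x * w1 i) + 2 * complex.Re (cis y * w2 i) != E].
Proof.
move=> w12 w12J /andP[E1 E2]; pose e := E / 2.
have eE : E = 2 * e by rewrite /e; field.
pose Q i := coincidence_poly (complex.Re (w1 i)) (complex.Im (w1 i))
  (complex.Re (w2 i)) (complex.Im (w2 i)) e.
have Q0 : \prod_i Q i != 0.
  apply/prodf_neq0 => i _; apply: coincidence_poly_neq0.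
    apply: contra (w12 i); case: (w1 i) (w2 i) => [a b] [c d] /=.
    rewrite paddr_eq0 ?sqr_ge0// !sqrf_eq0 !subr_eq0 => /andP[/eqP -> /eqP ->].
    by [].
  apply: contra (w12J i); case: (w1 i) (w2 i) => [a b] [c d] /=.
  rewrite paddr_eq0 ?sqr_ge0// !sqrf_eq0 subr_eq0 addr_eq0.
  by move=> /andP[/eqP -> /eqP ->].
(* On this window both [X] and [e - X] lie strictly between $-1$ and $1$; it is nonempty because
   $|e|<2$. *)
have [|X [/andP[X1 X2] QX]] := @poly_nonroot _ (Num.max (-1) (e - 1))
    (Num.min 1 (e + 1)) Q0.
  by rewrite gt_max !lt_min /e; apply/andP; split; apply/andP; split; lra.
move: X1 X2; rewrite gt_max lt_min => /andP[X1 X1'] /andP[X2 X2'].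
have Xin : -1 <= X <= 1 by apply/andP; split; lra.
have Yin : -1 <= e - X <= 1 by apply/andP; split; lra.
have cX : cos (acos X) = X by rewrite acosK// in_itv.
have cY : cos (acos (e - X)) = e - X by rewrite acosK// in_itv.
exists (acos X), (acos (e - X)); split.
- by rewrite acos_gt0 ?acos_ltpi//; apply/andP; split; lra.
- by rewrite cX cY eE; ring.
move=> i; apply: contra_neq QX => co; rewrite horner_prod (bigD1 i)//=.
rewrite (@coincidence_polyP _ _ _ _ _ X (sin (acos X)) (e - X)
  (sin (acos (e - X)))) ?mul0r//.
- by rewrite -{1}cX cos2Dsin2.
- by rewrite -{1}cY cos2Dsin2.
- by ring.
move: co; rewrite eE !cisE cX cY; case: (w1 i) (w2 i) => [a b] [c d] /=; lra.
Qed.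

Lemma finite_lower_bound (I : finType) (f : I -> R) : (forall i, 0 < f i) ->
  exists2 h : R, 0 < h & forall i, h <= f i.
Proof.
move=> f0; suff [h h0 H] : exists2 h : R, 0 < h & forall i, i \in enum I -> h <= f i.
  by exists h => // i; apply: H; rewrite mem_enum.
elim: (enum I) => [|i r [h h0 H]]; first by exists 1.
exists (Num.min h (f i)); first by rewrite lt_min h0 f0.
move=> j; rewrite inE => /orP[/eqP ->|/H hj]; first by rewrite ge_min lexx orbT.
by rewrite ge_min hj.
Qed.

Lemma sign_change (A B a b e : R) : A * B < 0 -> e <= `|A| -> e <= `|B| ->
  `|A - a| <= e / 2 -> `|B - b| <= e / 2 ->
  Num.min a b <= 0 <= Num.max a b.
Proof.
wlog A0 : A B a b / A < 0.
  move=> H AB eA eB; have [A0|A0|A0] := ltgtP A 0.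
  - exact: H AB eA eB.
  - rewrite minC maxC => hA hB.
    have B0 : B < 0 by rewrite pmulr_rlt0 in AB.
    by apply: (H B A b a B0 _ eB eA hB hA); rewrite mulrC.
  - by rewrite A0 mul0r ltxx in AB.
rewrite nmulr_rlt0// => B0; rewrite ltr0_norm// gtr0_norm// !ler_norml.
move=> eA eB /andP[h1 h2] /andP[h3 h4]; rewrite ge_min le_max.
by apply/andP; split; apply/orP; [left|right]; lra.
Qed.

End LevelCurve.

(** * Eigenvalues that survive small perturbations *)

Section Interior.
Variables (R : realType) (p q : nat).
Hypotheses (p0 : (0 < p)%N) (q0 : (0 < q)%N) (pq : coprime p q).
Variables z1 z2 : R[i].
Hypotheses (z1p : p.-primitive_root z1) (z2q : q.-primitive_root z2).

Notation K := ('I_p * 'I_q)%type.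
Let k0 : K := (Ordinal p0, Ordinal q0).

Lemma norm_nsq (z : R[i]) : `|z| = (Num.sqrt (nsq z))%:C.
Proof. by case: z. Qed.

Lemma Re_le_norm (z : R[i]) (x : R) : `|z| <= x%:C -> `|complex.Re z| <= x.
Proof.
rewrite norm_nsq lecR; apply: le_trans.
rewrite -sqrtr_sqr ler_wsqrtr// /nsq lerDl; exact: sqr_ge0.
Qed.

Lemma nsq1_norm (z : R[i]) : nsq z = 1 -> `|z| = 1.
Proof. by rewrite norm_nsq => ->; rewrite sqrtr1. Qed.

Lemma norm_real_complex (x : R) : `|x%:C| = `|x|%:C.
Proof. by rewrite norm_nsq nsqC sqrtr_sqr. Qed.

Lemma nsq1_Re (z : R[i]) : nsq z = 1 -> `|complex.Re z| <= 1.
Proof. by move=> /nsq1_norm zn; apply: Re_le_norm; rewrite zn. Qed.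

Lemma nsq1_Im (z : R[i]) : nsq z = 1 -> `|complex.Im z| <= 1.
Proof.
move=> zn; have := @nsq1_Re ('i * z); rewrite nsqM zn mulr1.
rewrite {1}/nsq /= expr0n expr1n add0r => /(_ erefl).
by case: z zn => a b _ /=; rewrite mul0r mul1r sub0r normrN.
Qed.

Lemma root_unit1 (k : 'I_p) : nsq (z1 ^+ k) = 1.
Proof. by rewrite nsqX (nsq_prim_root z1p) expr1n. Qed.

Lemma root_unit2 (k : 'I_q) : nsq (z2 ^+ k) = 1.
Proof. by rewrite nsqX (nsq_prim_root z2q) expr1n. Qed.

Lemma symbol_bound s t (k : K) : `|symbol z1 z2 s t k| <= 4.
Proof.
have h1 : `|complex.Re (cis s * z1 ^+ k.1)| <= 1.
  by apply: nsq1_Re; rewrite nsqM nsq_cis root_unit1 mulr1.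
have h2 : `|complex.Re (cis t * z2 ^+ k.2)| <= 1.
  by apply: nsq1_Re; rewrite nsqM nsq_cis root_unit2 mulr1.
rewrite /symbol; move: h1 h2; rewrite !ler_norml => /andP[? ?] /andP[? ?].
by apply/andP; split; lra.
Qed.

Lemma symbol_lipschitz s s' t (k : K) :
  `|symbol z1 z2 s t k - symbol z1 z2 s' t k| <= 4 * `|s - s'|.
Proof.
rewrite /symbol opprD addrACA subrr addr0 -mulrBr normrM ger0_norm//.
rewrite (_ : 4 = 2 * 2); last by ring.
rewrite -mulrA ler_wpM2l//.
have := root_unit1 k.1; move: (z1 ^+ k.1) => w w1.
have wR := nsq1_Re w1; have wI := nsq1_Im w1.
have [hc hs] := cos_sin_lipschitz s s'.
have -> : complex.Re (cis s * w) - complex.Re (cis s' * w) =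
    (cos s - cos s') * complex.Re w - (sin s - sin s') * complex.Im w.
  by rewrite !cisE; case: w {w1 wR wI} => a b /=; ring.
rewrite (le_trans (ler_normB _ _))// !normrM mulr2n mulrDl mul1r lerD//.
  by rewrite -[leRHS]mulr1 ler_pM.
by rewrite -[leRHS]mulr1 ler_pM.
Qed.

Lemma Vhat_dist (V V' : lattice -> R) (d : R) (k k' : K) :
  (forall n, `|V n - V' n| <= d) ->
  `|Vhat z1 z2 V k k' - Vhat z1 z2 V' k k'| <= d%:C.
Proof.
move=> Vd; have NR : 0 < #|{: K}|%:R :> R[i].
  by rewrite ltr0n card_prod !card_ord muln_gt0 p0.
rewrite /Vhat /fourier -mulrBr -sumrB normrM normfV (ger0_norm (ltW NR)).
rewrite mulrC ler_pdivrMr// (le_trans (ler_norm_sum _ _ _))//.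
rewrite mulr_natr -sumr_const; apply: ler_sum => h _.
have := nsq1_norm (nsq_chi z1p z2q 0 0 k (cell h)).
have := nsq1_norm (nsq_chi z1p z2q 0 0 k' (cell h)).
move: (chi z1 z2 0 0 k _) (chi z1 z2 0 0 k' _) => u v v1 u1.
rewrite -mulrBl -mulrBl !normrM norm_conjC u1 v1 !mulr1 -rmorphB.
by rewrite /= norm_real_complex lecR.
Qed.

Lemma Vhat0 (k k' : K) : Vhat z1 z2 (fun=> 0 : R) k k' = 0.
Proof.
by rewrite /Vhat /fourier big1 ?mulr0// => h _; rewrite !mul0r.
Qed.

Lemma Vhat_bound (V : lattice -> R) (d : R) (k k' : K) :
  (forall n, `|V n| <= d) -> `|Vhat z1 z2 V k k'| <= d%:C.
Proof.
move=> Vd; have := @Vhat_dist V (fun=> 0) d k k'; rewrite Vhat0 subr0; apply.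
by move=> n; rewrite subr0.
Qed.

Let g (V : lattice -> R) (E s t : R) : R :=
  complex.Re (\det (floquet_mx p q z1 z2 V s t E)).

(** One estimate serves twice: to compare the perturbed determinant with the free one, and to get
    continuity in [s]. *)
Let g_lipschitz : exists2 C : R, 0 < C &
  forall V V' E E' s s' t d, (forall n, `|V n| <= 1) ->
    (forall n, `|V' n| <= 1) -> `|E| <= 5 -> `|E'| <= 5 ->
    (forall n, `|V n - V' n| <= d) ->
    `|g V E s t - g V' E' s' t| <= C * (4 * `|s - s'| + `|E - E'| + d).
Proof.
pose n := #|{: K}|.
(* The entries are at most 10 in modulus: 4 from the symbol, 5 from the energy, 1 from the
   potential. *)
pose C : R := #|{perm 'I_n}|%:R * (n%:R * 10 ^+ n).
have C0 : 0 <= C by rewrite !mulr_ge0// exprn_ge0.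
exists (C + 1) => [|V V' E E' s s' t d V1 V1' E1 E1' Vd]; first by lra.
set D := 4 * _ + _ + d.
have D0 : 0 <= D.
  by rewrite !addr_ge0 ?mulr_ge0// (le_trans _ (Vd 0)).
apply: (@le_trans _ _ (C * D)); last by rewrite ler_wpM2r// lerDl.
have entry V0 E0 s0 : (forall n, `|V0 n| <= 1) -> `|E0| <= 5 ->
    forall i j, `|floquet_mx p q z1 z2 V0 s0 t E0 i j| <= 10%:C.
  move=> h1 h2 i j; rewrite mxE (le_trans (ler_normD _ _))//.
  have h3 := Vhat_bound (enum_val j) (enum_val i) h1.
  apply: (@le_trans _ _ (9%:C + 1%:C)); last first.
    by rewrite -rmorphD lecR /=; lra.
  apply: lerD => //; case: (i == j); last first.
    by rewrite mul0r normr0 lecR.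
  rewrite mul1r norm_real_complex lecR (le_trans (ler_normB _ _))//.
  have := symbol_bound s0 t (enum_val j); lra.
have diff i j : `|floquet_mx p q z1 z2 V s t E i j -
    floquet_mx p q z1 z2 V' s' t E' i j| <= D%:C.
  rewrite !mxE opprD addrACA -mulrBr -rmorphB /=.
  rewrite (le_trans (ler_normD _ _))//.
  have h3 := Vhat_dist (enum_val j) (enum_val i) Vd.
  apply: (@le_trans _ _ ((4 * `|s - s'| + `|E - E'|)%:C + d%:C)); last first.
    by rewrite -rmorphD lecR.
  apply: lerD => //; case: (i == j); last first.
    by rewrite mul0r normr0 lecR addr_ge0// mulr_ge0.
  rewrite mul1r norm_real_complex lecR.
  have h4 := symbol_lipschitz s s' t (enum_val j).
  have h5 := lerD h4 (lexx `|E - E'|).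
  apply: le_trans h5; apply: le_trans (ler_normB _ _).
  by rewrite le_eqVlt; apply/orP; left; apply/eqP; congr `|_|; ring.
have M1 : 1 <= 10%:C :> R[i] by rewrite -[1]/(1%:C) lecR; lra.
have := det_lipschitz M1 (entry V E s V1 E1) (entry V' E' s' V1' E1') diff.
rewrite /g => H.
have -> : complex.Re (\det (floquet_mx p q z1 z2 V s t E)) -
  complex.Re (\det (floquet_mx p q z1 z2 V' s' t E')) =
  complex.Re (\det (floquet_mx p q z1 z2 V s t E) -
              \det (floquet_mx p q z1 z2 V' s' t E')).
  by case: (\det _) (\det _) => ? ? [? ?].
apply: Re_le_norm; apply: (le_trans H).
rewrite le_eqVlt; apply/orP; left; apply/eqP.
by rewrite /C !rmorphM /= !rmorphXn /= !rmorph_nat !mulrA.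
Qed.

Let g_free (E s t : R) : g (fun=> 0) E s t = \prod_(k : K) (symbol z1 z2 s t k - E).
Proof.
pose r : 'rV[R[i]]_#|{: K}| := \row_i (symbol z1 z2 s t (enum_val i) - E)%:C.
have -> : g (fun=> 0) E s t = complex.Re (\det (diag_mx r)).
  congr (complex.Re (\det _)); apply/matrixP => i j; rewrite !mxE Vhat0 addr0.
  by case: eqVneq => [->|]; rewrite ?mul1r ?mul0r.
rewrite det_diag.
transitivity (complex.Re (\prod_(k : K) (symbol z1 z2 s t k - E))%:C) => //.
congr complex.Re; rewrite rmorph_prod (reindex (@enum_val {: K} predT)) /=; last first.
  by exists enum_rank => i _; rewrite ?enum_rankK ?enum_valK.
by apply: eq_bigr => i _; rewrite mxE.
Qed.

(** Here coprimality enters: if [z1 ^+ i] is also a [q]-th root of unity then [p] divides [i * q],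
    hence [i], so [i = 0] and both roots equal 1. The conjugate of a [q]-th root of unity is again
    one. *)
Let k0P (k : K) : k != k0 -> z1 ^+ k.1 != z2 ^+ k.2 /\ z1 ^+ k.1 != (z2 ^+ k.2)^*.
Proof.
case: k => i j; rewrite -pair_eqE /pair_eq /= => ij.
have key (w : R[i]) : w ^+ q = 1 -> (w = 1 -> j = Ordinal q0) -> z1 ^+ i != w.
  move=> wq w1; apply/eqP => iw; move: ij.
  have : z1 ^+ (i * q) = 1 by rewrite exprM iw.
  move=> /eqP; rewrite -(prim_order_dvd z1p) Gauss_dvdl//.
  have [i0|ipos] := posnP i; last by move=> /(dvdn_leq ipos); rewrite leqNgt ltn_ord.
  move=> _; rewrite w1 ?eqxx ?andbT; last by rewrite -iw i0 expr0.
  by move/eqP; apply; apply: val_inj.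
have jq : (z2 ^+ j) ^+ q = 1 by rewrite -exprM mulnC exprM (prim_expr_order z2q) expr1n.
have j1 : z2 ^+ j = 1 -> j = Ordinal q0.
  move=> /eqP; rewrite -(prim_order_dvd z2q) => qj; apply: val_inj => /=.
  by have [//|jpos] := posnP j; move: (dvdn_leq jpos qj); rewrite leqNgt ltn_ord.
split; first exact: key.
apply: key; first by rewrite -rmorphXn jq rmorph1.
by move=> /(congr1 Num.conj); rewrite conjCK rmorph1.
Qed.

Lemma floquet_eigen_near (E0 : R) : -4 < E0 < 4 -> exists2 d : R, 0 < d &
  forall V E, periodic2 p q V -> `|E0 - E| <= d -> (forall n, `|V n| <= d) ->
  exists s t, exists2 a : K -> R[i], 0 < \sum_k nsq (a k) &
    forall k, floquet z1 z2 V s t a k - E%:C * a k = 0.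
Proof.
move=> E04; have /andP[E0l E0r] := E04.
pose w1 (k : {k : K | k != k0}) := z1 ^+ (val k).1.
pose w2 (k : {k : K | k != k0}) := z2 ^+ (val k).2.
have [||x [y [/andP[x0 xpi] xyE gen]]] := @generic_level_point R _ w1 w2 E0 _ _ E04.
- by move=> k; have [] := k0P (valP k).
- by move=> k; have [] := k0P (valP k).
have sym0 s : symbol z1 z2 s y k0 = 2 * cos s + 2 * cos y.
  by rewrite /symbol /= !expr0 !mulr1 !cisE.
have [m m0 Hm] : exists2 m : R, 0 < m &
    forall k : K, k != k0 -> m <= `|symbol z1 z2 x y k - E0|.
  pose f (k : {k : K | k != k0}) := `|symbol z1 z2 x y (val k) - E0|.
  have [|m m0 Hm] := @finite_lower_bound R _ f.
    by move=> k; rewrite normr_gt0 subr_eq0; exact: gen.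
  by exists m => // k kk0; exact: (Hm (exist _ k kk0)).
(* Moving [s] by [h] changes a symbol by at most [4 * h], less than the distance [m] of the other
   symbols from [E0]; the remaining bounds keep [x - h] and [x + h] where cosine decreases. *)
have [h [h0 hm hx hpi]] : exists h : R, [/\ 0 < h, 4 * h < m, h < x & x + h < pi].
  exists (Num.min (m / 8) (Num.min (x / 2) ((pi - x) / 2))).
  set h := Num.min _ _.
  have h1 : h <= m / 8 by rewrite ge_min lexx.
  have h2 : h <= x / 2 by rewrite !ge_min lexx orbT.
  have h3 : h <= (pi - x) / 2 by rewrite !ge_min lexx !orbT.
  split; [|lra|lra|lra].
  by rewrite !lt_min; apply/and3P; split; lra.
pose P s := g (fun=> 0) E0 s y.
have cosx1 : cos (x + h) < cos x.
  rewrite ltr_cos ?in_itv /=; first by rewrite ltrDl.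
  - by apply/andP; split; lra.
  - by apply/andP; split; lra.
have cosx2 : cos x < cos (x - h).
  rewrite ltr_cos ?in_itv /=; first by rewrite ltrBlDr ltrDl.
  - by apply/andP; split; lra.
  - by apply/andP; split; lra.
(* Between the two ends only the factor of [k0] changes sign; every other factor has equal signs at
   both and contributes a positive product. *)
have PP : P (x - h) * P (x + h) < 0.
  rewrite /P !g_free -big_split (bigD1 k0)//= pmulr_llt0.
    rewrite !sym0 nmulr_llt0; first by rewrite -xyE; lra.
    by rewrite -xyE; lra.
  apply: prodr_gt0 => k kk0.
  have hk := Hm k kk0.
  have l1 := symbol_lipschitz (x - h) x y k.
  have l2 := symbol_lipschitz (x + h) x y k.
  move: hk l1 l2.
  have -> : x - h - x = - h by ring.
  have -> : x + h - x = h by ring.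
  rewrite normrN (gtr0_norm h0).
  rewrite !ler_norml; set f := symbol z1 z2 x y k.
  set f1 := symbol z1 z2 (x - h) y k; set f2 := symbol z1 z2 (x + h) y k.
  move=> hk /andP[a1 a2] /andP[b1 b2].
  have [f0|f0] := leP 0 (f - E0).
    by rewrite ger0_norm// in hk; apply: mulr_gt0; lra.
  by rewrite ltr0_norm// in hk; rewrite nmulr_rgt0; lra.
have [C C0 Cg] := g_lipschitz.
have P1 : P (x - h) != 0 by apply: contraTneq PP => ->; rewrite mul0r ltxx.
have P2 : P (x + h) != 0 by apply: contraTneq PP => ->; rewrite mulr0 ltxx.
pose eta := Num.min `|P (x - h)| `|P (x + h)|.
have eta0 : 0 < eta by rewrite lt_min !normr_gt0 P1 P2.
(* The bound 1 keeps [V] and [E] within the range of [g_lipschitz]; the other one limits the change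
   of the determinant to half its smaller end value. *)
exists (Num.min 1 (eta / (4 * C))).
  by rewrite lt_min ltr01 divr_gt0// mulr_gt0.
set d := Num.min _ _ => V E Vper Ed Vd.
have d1 : d <= 1 by rewrite ge_min lexx.
have dC : C * (d + d) <= eta / 2.
  have : d <= eta / (4 * C) by rewrite ge_min lexx orbT.
  rewrite ler_pdivlMr ?mulr_gt0//; lra.
have V1 n : `|V n| <= 1 by rewrite (le_trans (Vd n)).
have E05 : `|E0| <= 5 by rewrite ler_norml; apply/andP; split; lra.
have E5 : `|E| <= 5.
  by move: Ed; rewrite !ler_norml => /andP[? ?]; apply/andP; split; lra.
have E0E : `|E0 - E| + d <= d + d by rewrite lerD2r.
clearbody d.
have close s : `|P s - g V E s y| <= eta / 2.
  have O1 (n : lattice) : `|(fun=> 0 : R) n| <= 1 by rewrite normr0.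
  have := Cg (fun=> 0) V E0 E s s y d O1 V1 E05 E5.
  rewrite subrr normr0 mulr0 add0r => H; apply: le_trans dC.
  apply: (le_trans (H _)).
  - by move=> n; rewrite sub0r normrN.
  - by apply: ler_wpM2l => //; exact: ltW.
have e1 : eta <= `|P (x - h)| by rewrite ge_min lexx.
have e2 : eta <= `|P (x + h)| by rewrite ge_min lexx orbT.
have gcont : continuous (fun s => g V E s y).
  move=> s; apply/cvgrPdist_lt => e e0.
  have C4 : 0 < 4 * C by rewrite mulr_gt0.
  apply/nbhs_ballP; exists (e / (4 * C)); first by rewrite /= divr_gt0.
  move=> u; rewrite /ball /=.
  rewrite ltr_pdivlMr// => H.
  have := Cg V V E E s u y 0 V1 V1 E5 E5.
  rewrite subrr normr0 !addr0 => /(_ _)/le_lt_trans; apply.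
    by move=> n; rewrite subrr normr0.
  lra.
have xh : x - h <= x + h by lra.
have [||s _ gs] := @IVT _ (fun s => g V E s y) _ _ 0 xh.
- exact: continuous_subspaceT.
- have := close (x - h); have := close (x + h).
  move: PP e1 e2.
  set A := P (x - h); set B := P (x + h).
  set a := g V E (x - h) y; set b := g V E (x + h) y.
  by move=> AB eA eB cB cA; exact: (sign_change AB eA eB).
exists s, y; apply: (floquet_mx_det0 (V := V)).
have := @floquet_mx_det_real R p q z1 z2 V s y E; move: gs; rewrite /g.
by case: (\det _) => a b /= -> ->.
Qed.

End Interior.

(** * The edges of the spectrum *)

Section Supersolution.
Variables (R : realType) (V : lattice -> R) (M : R).
Hypothesis VM : forall n, `|V n| <= M.

Definition nbr_sum (f : lattice -> R) (n : lattice) : R :=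
  f (n - (1, 0)) + f (n + (1, 0)) + (f (n - (0, 1)) + f (n + (0, 1))).

Variables (phi : lattice -> R) (m P E : R).
Hypotheses (m0 : 0 < m) (phi_ge : forall n, m <= phi n)
  (phi_le : forall n, phi n <= P).
Hypothesis super : forall n, nbr_sum phi n <= (E - V n) * phi n.

Let phi0 n : 0 < phi n.
Proof. exact: lt_le_trans m0 (phi_ge n). Qed.

Let ratio a n := phi (n + a) / phi n.

Let ratio_bound a n : 0 <= ratio a n <= P / m.
Proof.
rewrite divr_ge0 ?(ltW (phi0 _))//=; apply: ler_pM => //.
- exact: ltW (phi0 _).
- by rewrite invr_ge0 ltW.
- by rewrite lef_pV2 ?posrE.
Qed.

Let lsummable_ratio (u : lattice -> R[i]) a : l2 u ->
  lsummable (fun n => ratio a n * nsq (u n)).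
Proof.
move=> /l2P su; apply: lsummable_le (lsummableZ (P / m) su) => n.
have /andP[r0 r1] := ratio_bound a n; have u0 := nsq_ge0 (u n).
by rewrite ger0_norm; [exact: ler_wpM2r|exact: mulr_ge0].
Qed.

(** On the edge from $n$ to $n+a$, with $x=\phi(n)$ and $y=\phi(n+a)$, the defect is
    $|y\,u(n)-x\,u(n+a)|^2/(xy)$. A translation by [a] brings the second sum to the same edge. *)
Let hop_le (u : lattice -> R[i]) (a : lattice) : l2 u ->
  2 * lsum (fun n => rdot (u (n + a)) (u n)) <=
  lsum (fun n => ratio a n * nsq (u n)) +
  lsum (fun n => ratio (- a) n * nsq (u n)).
Proof.
move=> u2; have /l2P su := u2.
have sr b : lsummable (fun n => ratio b n * nsq (u n)) by exact: lsummable_ratio.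
have sh := lsummable_rdot (l2_shift a u2) u2.
rewrite -(lsum_shift (fun n => ratio (- a) n * nsq (u n)) a).
have srs := lsummable_shift a (sr (- a)).
rewrite -lsumD// -lsumZ//; apply: le_lsum; first exact: lsummableZ.
  exact: lsummableD.
move=> n; rewrite /ratio addrK; have p1 := phi0 n; have p2 := phi0 (n + a).
move: (phi n) (phi (n + a)) (u n) (u (n + a)) p1 p2 => x y w v x0 y0.
rewrite -subr_ge0.
have -> : y / x * nsq w + x / y * nsq v - 2 * rdot v w =
    (x * y)^-1 * nsq (y%:C * w - x%:C * v).
  rewrite nsqB !nsqM !nsqC rdotZl [rdot w _]rdotC rdotZl.
  by field; rewrite !gt_eqF.
by rewrite mulr_ge0 ?nsq_ge0// invr_ge0 mulr_ge0// ltW.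
Qed.

(* The discrete Allegretto--Piepenbrink argument: a positive supersolution
   bounds the quadratic form edge by edge. *)
Lemma supersolution_form_le u : l2 u ->
  lsum (fun n => rdot (schrodinger V u n) (u n)) <= E * sqnorm u.
Proof.
move=> u2; have /l2P su := u2.
pose hop a := lsum (fun n => rdot (u (n + a)) (u n)).
pose rs a := lsum (fun n => ratio a n * nsq (u n)).
have sh a := lsummable_rdot (l2_shift a u2) u2.
have sr b : lsummable (fun n => ratio b n * nsq (u n)) by exact: lsummable_ratio.
have sV : lsummable (fun n => V n * nsq (u n)).
  apply: lsummable_le (lsummableZ M su) => n.
  by rewrite normrM (ger0_norm (nsq_ge0 _)) ler_wpM2r ?nsq_ge0.
have h1 := lsummableD (sh (- (1, 0))) (sh (1, 0)).
have h2 := lsummableD (sh (- (0, 1))) (sh (0, 1)).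
have -> : lsum (fun n => rdot (schrodinger V u n) (u n)) =
    hop (- (1, 0)) + hop (1, 0) + (hop (- (0, 1)) + hop (0, 1)) +
    lsum (fun n => V n * nsq (u n)).
  rewrite /hop -(lsumD (sh _) (sh _)) -(lsumD (sh _) (sh _)) -(lsumD h1 h2).
  rewrite -(lsumD (lsummableD h1 h2) sV).
  apply: eq_lsum => n; rewrite /schrodinger /laplacian.
  by rewrite !rdotDl rdotZl rdotxx.
have r1 := lsummableD (sr (- (1, 0))) (sr (1, 0)).
have r2 := lsummableD (sr (- (0, 1))) (sr (0, 1)).
have R0 : rs (- (1, 0)) + rs (1, 0) + (rs (- (0, 1)) + rs (0, 1)) +
    lsum (fun n => V n * nsq (u n)) <= E * sqnorm u.
  rewrite /rs -(lsumD (sr _) (sr _)) -(lsumD (sr _) (sr _)) -(lsumD r1 r2).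
  rewrite -(lsumD (lsummableD r1 r2) sV) -lsumZ//.
  apply: le_lsum; [exact: lsummableD (lsummableD r1 r2) sV|exact: lsummableZ|].
  move=> n.
  have key : ratio (- (1, 0)) n + ratio (1, 0) n +
      (ratio (- (0, 1)) n + ratio (0, 1) n) + V n <= E.
    rewrite /ratio -!mulrDl -lerBrDr ler_pdivrMr; first exact: super.
    exact: phi0.
  have := ler_wpM2r (nsq_ge0 (u n)) key.
  move: (ratio _ _) (ratio _ _) (ratio _ _) (ratio _ _) => r3 r4 r5 r6; lra.
have a1 := hop_le (- (1, 0)) u2; have a2 := hop_le (1, 0) u2.
have a3 := hop_le (- (0, 1)) u2; have a4 := hop_le (0, 1) u2.
rewrite opprK -/(rs _) -/(rs _) -/(hop _) in a1.
rewrite -/(rs _) -/(rs _) -/(hop _) in a2.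
rewrite opprK -/(rs _) -/(rs _) -/(hop _) in a3.
rewrite -/(rs _) -/(rs _) -/(hop _) in a4.
lra.
Qed.

(** The form bound makes $E_2-T$ coercive with constant $E_2-E$, and [E2] is its own conjugate, so
    one lower bound serves both demands of [not_spectrum]. *)
Lemma not_spectrum_above (E2 : R) : E < E2 -> ~ spectrum (schrodinger V) E2%:C.
Proof.
move=> EE2; have d0 : 0 < (E2 - E) ^+ 2 by rewrite exprn_gt0// subr_gt0.
have below v : l2 v -> (E2 - E) ^+ 2 * sqnorm v <= sqnorm (shifted V E2%:C v).
  move=> v2; have w2 := l2_shifted VM E2%:C v2.
  have -> : sqnorm (shifted V E2%:C v) = sqnorm (fun n => (-1) * shifted V E2%:C v n).
    by apply: eq_lsum => n; rewrite mulN1r nsqN.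
  have mw2 := l2Z (-1) w2.
  apply: coercive_bounded_below => //; first by rewrite subr_ge0 ltW.
  have /l2P sv := v2; have Tv := lsummable_rdot (l2_schrodinger VM v2) v2.
  have -> : lsum (fun n => rdot (-1 * shifted V E2%:C v n) (v n)) =
      E2 * sqnorm v - lsum (fun n => rdot (schrodinger V v n) (v n)).
    rewrite /sqnorm -lsumZ// -lsumB//; last exact: lsummableZ.
    apply: eq_lsum => n; rewrite /shifted mulN1r opprB rdotBl rdotZl.
    by rewrite rdotxx.
  by rewrite mulrBl lerD2l lerN2; exact: supersolution_form_le.
apply: (not_spectrum VM d0) => // v v2.
have -> : (E2%:C)^* = E2%:C :> R[i] by exact: conjc_real.
exact: below.
Qed.

End Supersolution.

(** * Positivity of the Floquet forms near the upper edge *)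

Section UpperEdge.
Variables (R : realType) (p q : nat).
Hypotheses (p0 : (0 < p)%N) (q0 : (0 < q)%N).
Variables z1 z2 : R[i].
Hypotheses (z1p : p.-primitive_root z1) (z2q : q.-primitive_root z2).

Notation K := ('I_p * 'I_q)%type.
Let k0 : K := (Ordinal p0, Ordinal q0).

(** Here $w^p=-1$ for every first factor $w$, so $w\ne 1$ and its real part is below 1; finiteness
    of [K] makes this uniform. The factor 2 leaves one [e] for the energy and one for the
    potential. *)
Lemma antiperiodic_symbol_gap : exists2 e : R, 0 < e &
  forall k : K, symbol z1 z2 (pi / p%:R) 0 k <= 4 - 2 * e.
Proof.
have pR : p%:R != 0 :> R by rewrite pnatr_eq0 -lt0n.
pose f (k : K) := (4 - symbol z1 z2 (pi / p%:R) 0 k) / 2.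
have [|e e0 He] := @finite_lower_bound R _ f; last first.
  by exists e => // k; have := He k; rewrite /f; lra.
move=> k; rewrite /f /symbol.
set w := cis _ * z1 ^+ k.1; set v := cis 0 * z2 ^+ k.2.
have w1 : nsq w = 1 by rewrite nsqM nsq_cis (root_unit1 z1p) mulr1.
have v1 : nsq v = 1 by rewrite nsqM nsq_cis (root_unit2 z2q) mulr1.
have := nsq1_Re w1; have := nsq1_Re v1; rewrite !ler_norml.
move=> /andP[_ hv] /andP[_ hw].
have : complex.Re w != 1.
  apply/eqP => Rw; have wE : w = 1.
    move: w1 Rw; case: (w) => a b; rewrite /nsq /= => ab a1.
    have /eqP : b ^+ 2 = 0 by rewrite a1 in ab; lra.
    by rewrite sqrf_eq0 => /eqP ->; rewrite a1.
  have := congr1 (fun x => x ^+ p) wE; rewrite expr1n /w exprMn -exprM mulnC.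
  rewrite exprM (prim_expr_order z1p) expr1n mulr1 cisX mulrC divfK// cisE.
  rewrite cospi sinpi => /(congr1 (@complex.Re R)) /=; lra.
rewrite -subr_eq0 => wn1.
have : complex.Re w < 1 by rewrite lt_neqAle hw andbT -subr_eq0.
lra.
Qed.

Variables (V : lattice -> R) (d E : R).
Hypotheses (Vper : periodic2 p q V) (Vd : forall n, `|V n| <= d).

Definition gap_form s (a : K -> R[i]) : R :=
  \sum_k rdot (E%:C * a k - floquet z1 z2 V s 0 a k) (a k).

Let floquetB s (a b : K -> R[i]) (r : R) k :
  E%:C * (a k - r%:C * b k) -
    floquet z1 z2 V s 0 (fun k => a k - r%:C * b k) k =
  (E%:C * a k - floquet z1 z2 V s 0 a k) -
  r%:C * (E%:C * b k - floquet z1 z2 V s 0 b k).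
Proof.
rewrite /floquet.
have -> : potential z1 z2 V (fun k => a k - r%:C * b k) k =
    potential z1 z2 V a k - r%:C * potential z1 z2 V b k.
  rewrite /potential mulr_sumr -sumrB; apply: eq_bigr => k' _.
  by ring.
ring.
Qed.

Let gap_formE s a : gap_form s a = \sum_k (E - symbol z1 z2 s 0 k) * nsq (a k) -
  \sum_k rdot (potential z1 z2 V a k) (a k).
Proof.
rewrite -sumrB; apply: eq_bigr => k _.
by rewrite /floquet rdotBl rdotZl rdotDl rdotZl rdotxx; ring.
Qed.

Lemma gap_form_bounds s (a : K -> R[i]) (l r : R) :
  (forall k : K, l <= E - symbol z1 z2 s 0 k <= r) ->
  (l - d) * (\sum_k nsq (a k)) <= gap_form s a <= (r + d) * (\sum_k nsq (a k)).
Proof.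
move=> lr; rewrite gap_formE.
have := potential_form p0 q0 z1p z2q Vper a Vd; rewrite ler_norml => /andP[h1 h2].
have h3 : l * (\sum_k nsq (a k)) <= \sum_k (E - symbol z1 z2 s 0 k) * nsq (a k).
  rewrite mulr_sumr; apply: ler_sum => k _; have /andP[l1 _] := lr k.
  by rewrite ler_wpM2r ?nsq_ge0.
have h4 : \sum_k (E - symbol z1 z2 s 0 k) * nsq (a k) <= r * (\sum_k nsq (a k)).
  rewrite mulr_sumr; apply: ler_sum => k _; have /andP[_ l1] := lr k.
  by rewrite ler_wpM2r ?nsq_ge0.
by rewrite mulrBl mulrDl; apply/andP; split; lra.
Qed.

Variable c : R.
Hypothesis c0 : 0 < c.
Hypothesis below : forall s t (a : K -> R[i]), c * \sum_k nsq (a k) <=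
  \sum_k nsq (floquet z1 z2 V s t a k - E%:C * a k).

Let d0 : 0 <= d. Proof. exact: le_trans (normr_ge0 _) (Vd 0). Qed.

(** An upper bound for the form of $E$ minus the Floquet matrix: energy and symbol give [|E| + 4],
    the potential [d]. *)
Let L : R := `|E| + 4 + d + 1.

Let L0 : 0 < L.
Proof. by have := d0; have := normr_ge0 E; rewrite /L; lra. Qed.

(** For a nonnegative symmetric $A\le L$, testing $A\ge 0$ on $a-L^{-1}Aa$ gives $\langle
    Aa,a\rangle\ge L^{-1}\|Aa\|^2$, and [below] bounds the right side. No diagonalization is
    involved. *)
Let form_step s : (forall a, 0 <= gap_form s a) ->
  forall a, c / L * (\sum_k nsq (a k)) <= gap_form s a.
Proof.
move=> f0 a; pose w k := E%:C * a k - floquet z1 z2 V s 0 a k.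
have Li0 : 0 < L^-1 by rewrite invr_gt0.
have cw : c * (\sum_k nsq (a k)) <= \sum_k nsq (w k).
  rewrite (le_trans (below s 0 a))// le_eqVlt; apply/orP; left; apply/eqP.
  by apply: eq_bigr => k _; rewrite /w -opprB nsqN.
have wL : gap_form s w <= L * \sum_k nsq (w k).
  have := @gap_form_bounds s w (- (`|E| + 4)) (`|E| + 4).
  have bnd (k : K) : - (`|E| + 4) <= E - symbol z1 z2 s 0 k <= `|E| + 4.
    rewrite -ler_norml (le_trans (ler_normB _ _))// lerD2l.
    exact: symbol_bound.
  move=> /(_ bnd)/andP[_ h]; apply: le_trans h _.
  apply: ler_wpM2r; first by apply: sumr_ge0 => k _; exact: nsq_ge0.
  by rewrite /L lerDl.
have sym : \sum_k rdot (E%:C * w k - floquet z1 z2 V s 0 w k) (a k) =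
    \sum_k nsq (w k).
  transitivity (\sum_k E * rdot (w k) (a k) -
      \sum_k rdot (floquet z1 z2 V s 0 w k) (a k)).
    by rewrite -sumrB; apply: eq_bigr => k _; rewrite rdotBl rdotZl.
  rewrite floquet_sym -sumrB; apply: eq_bigr => k _.
  rewrite [rdot (w k) (a k)]rdotC [rdot (w k) (floquet _ _ _ _ _ _ _)]rdotC.
  by rewrite -rdotZl -rdotBl -/(w k) rdotxx.
have := f0 (fun k => a k - L^-1%:C * w k).
have -> : gap_form s (fun k => a k - L^-1%:C * w k) =
    gap_form s a - 2 * L^-1 * (\sum_k nsq (w k)) + L^-1 ^+ 2 * gap_form s w.
  transitivity (\sum_k (rdot (E%:C * a k - floquet z1 z2 V s 0 a k) (a k) -
      L^-1 * nsq (w k) -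
      L^-1 * rdot (E%:C * w k - floquet z1 z2 V s 0 w k) (a k) +
      L^-1 ^+ 2 * rdot (E%:C * w k - floquet z1 z2 V s 0 w k) (w k))).
    apply: eq_bigr => k _; rewrite floquetB -/(w k).
    move: (w k) (a k) (E%:C * w k - _) => [x1 x2] [y1 y2] [u1 u2].
    by rewrite /rdot /nsq /=; ring.
  rewrite big_split /= !sumrB -!mulr_sumr sym /gap_form; ring.
have h1 : L^-1 ^+ 2 * gap_form s w <= L^-1 * (\sum_k nsq (w k)).
  rewrite expr2 -mulrA ler_wpM2l ?(ltW Li0)// mulrC ler_pdivrMr// mulrC.
  exact: wL.
have h2 : L^-1 * (c * (\sum_k nsq (a k))) <= L^-1 * (\sum_k nsq (w k)).
  by rewrite ler_wpM2l ?(ltW Li0).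
rewrite (mulrC c) -mulrA; lra.
Qed.

(* The form cannot lose positivity along [s0 -> 0]: where it is nonnegative it
   is already bounded below by [c / L], hence it stays so on a uniform step. *)
Lemma gap_form_positive (s0 : R) :
  (forall a : K -> R[i], 0 <= gap_form s0 a) -> exists2 c1 : R, 0 < c1 &
  forall a : K -> R[i], c1 * (\sum_k nsq (a k)) <= gap_form 0 a.
Proof.
move=> fs0; have cL : 0 < c / L by rewrite divr_gt0.
(* So many steps that each moves every symbol by at most [c / L], the margin provided by
   [form_step]. *)
pose n := (Num.bound (4 * `|s0| / (c / L))).+1.
have n0 : 0 < n%:R :> R by rewrite ltr0n.
have small : 4 * `|s0| / n%:R <= c / L.
  rewrite ler_pdivrMr// [leRHS]mulrC -ler_pdivrMr//.
  have h : 0 <= 4 * `|s0| / (c / L).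
    by apply: divr_ge0; [exact: mulr_ge0|exact: ltW].
  by rewrite (le_trans (ltW (archi_boundP h)))// ler_nat.
pose s j := s0 * (1 - j%:R / n%:R).
have pos j : forall a, 0 <= gap_form (s j) a.
  elim: j => [|j IH] a; first by rewrite /s mul0r subr0 mulr1.
  have h1 := form_step IH a.
  have h2 : gap_form (s j) a - c / L * (\sum_k nsq (a k)) <= gap_form (s j.+1) a.
    rewrite !gap_formE mulr_sumr lerBlDr addrAC lerD2r -big_split.
    apply: ler_sum => k _ /=; rewrite -mulrDl ler_wpM2r ?nsq_ge0//.
    have := symbol_lipschitz z2 z1p (s j.+1) (s j) 0 k.
    have -> : s j.+1 - s j = - (s0 / n%:R).
      by rewrite /s -natr1; field; rewrite gt_eqF.
    rewrite normrN normrM normfV (gtr0_norm n0) mulrA => h3.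
    have := le_trans h3 small; rewrite ler_norml => /andP[_ h4].
    lra.
  by rewrite (le_trans _ h2)// subr_ge0.
exists (c / L) => //; apply: form_step => a; have := pos n a.
by rewrite /s divff ?gt_eqF// subrr mulr0.
Qed.

(* Pairing the equation for [phi] with its negative part [psi] shows
   [<psi, (E - T) psi> <= - <psi, 1>], so positivity of the form kills [psi]. *)
Let negative_part_eq0 (c1 : R) (phi : lattice -> R) : 0 < c1 ->
  (forall a : K -> R[i], c1 * (\sum_k nsq (a k)) <= gap_form 0 a) ->
  periodic2 p q phi -> (forall n, (E - V n) * phi n - nbr_sum phi n = 1) ->
  forall n, 0 <= phi n.
Proof.
move=> c10 pos phip eqn.
pose psi n := Num.max (- phi n) 0; pose phip' n := Num.max (phi n) 0.
have psi0 n : 0 <= psi n by rewrite le_max lexx orbT.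
have php0 n : 0 <= phip' n by rewrite le_max lexx orbT.
have split_phi n : phi n = phip' n - psi n /\ psi n * phip' n = 0.
  have [h|/ltW h] := leP 0 (phi n).
    have -> : psi n = 0 by apply: max_r; rewrite oppr_le0.
    have -> : phip' n = phi n by exact: max_l.
    by rewrite subr0 mul0r.
  have -> : psi n = - phi n by apply: max_l; rewrite oppr_ge0.
  have -> : phip' n = 0 by exact: max_r.
  by rewrite sub0r opprK mulr0.
pose psiC n : R[i] := (psi n)%:C.
have psiCp : periodic2 p q psiC.
  exact: (periodic2_comp (fun x => (Num.max (- x) 0)%:C)).
pose b : K -> R[i] := fourier z1 z2 psiC.
have psiE n : psiC n = bloch z1 z2 0 0 b n by exact: fourier_inversion.
have NR : 0 < #|{: K}|%:R :> R by rewrite ltr0n card_prod !card_ord muln_gt0 p0.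
pose Ab k := E%:C * b k - floquet z1 z2 V 0 0 b k.
have AbE n : bloch z1 z2 0 0 Ab n = ((E - V n) * psi n - nbr_sum psi n)%:C.
  have -> : bloch z1 z2 0 0 Ab n = E%:C * psiC n - schrodinger V psiC n.
    rewrite (funext psiE) (schrodinger_bloch p0 q0 z1p z2q Vper) /bloch mulr_sumr.
    by rewrite -sumrB; apply: eq_bigr => k _; rewrite mulrA -mulrBl.
  rewrite /schrodinger /laplacian /psiC /nbr_sum; move: (V n) (psi n).
  move: (psi (n - (1, 0))) (psi (n + (1, 0))) (psi (n - (0, 1))).
  move: (psi (n + (0, 1))) => x1 x2 x3 x4 x5 x6.
  by apply/eqP; rewrite eq_complex /=; apply/andP; split; apply/eqP; ring.
have pars1 := bloch_parseval z1p z2q 0 0 Ab b 0.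
have pars2 := bloch_parseval z1p z2q 0 0 b b 0.
have lo : c1 * (\sum_(h : K) psi (0 + cell h) ^+ 2) <=
    \sum_(h : K) ((E - V (0 + cell h)) * psi (0 + cell h) -
      nbr_sum psi (0 + cell h)) * psi (0 + cell h).
  have -> : \sum_(h : K) psi (0 + cell h) ^+ 2 = #|{: K}|%:R * \sum_k nsq (b k).
    transitivity (#|{: K}|%:R * \sum_k rdot (b k) (b k)); last first.
      by congr (_ * _); apply: eq_bigr => k _; rewrite rdotxx.
    by rewrite -pars2; apply: eq_bigr => h _; rewrite -psiE rdotxx nsqC.
  have -> : \sum_(h : K) ((E - V (0 + cell h)) * psi (0 + cell h) -
      nbr_sum psi (0 + cell h)) * psi (0 + cell h) = #|{: K}|%:R * gap_form 0 b.
    rewrite -pars1; apply: eq_bigr => h _; rewrite AbE -psiE.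
    by rewrite /rdot /= mulr0 addr0.
  by rewrite mulrCA ler_pM2l.
have up : \sum_(h : K) ((E - V (0 + cell h)) * psi (0 + cell h) -
      nbr_sum psi (0 + cell h)) * psi (0 + cell h) <= 0.
  (* Substituting [phi = phip' - psi] in the equation, the diagonal cross term vanishes since
     [psi * phip' = 0], and the hopping cross term has a sign since neighbours enter with positive
     coefficients. *)
  rewrite -oppr_ge0 -sumrN; apply: sumr_ge0 => h _.
  move: (0 + cell h) => n; have [phiE pp] := split_phi n.
  have hop : nbr_sum phi n = nbr_sum phip' n - nbr_sum psi n.
    rewrite /nbr_sum; have [-> _] := split_phi (n - (1, 0)).
    have [-> _] := split_phi (n + (1, 0)); have [-> _] := split_phi (n - (0, 1)).
    have [-> _] := split_phi (n + (0, 1)); ring.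
  have hop0 : 0 <= nbr_sum phip' n by rewrite !addr_ge0.
  have := eqn n; rewrite hop phiE => eqn'.
  have -> : - (((E - V n) * psi n - nbr_sum psi n) * psi n) =
      psi n * ((E - V n) * (phip' n - psi n) -
        (nbr_sum phip' n - nbr_sum psi n)) - (E - V n) * (psi n * phip' n) +
      psi n * nbr_sum phip' n by ring.
  by rewrite eqn' pp mulr0 subr0 mulr1 addr_ge0// mulr_ge0.
have S0 : \sum_(h : K) psi (0 + cell h) ^+ 2 <= 0.
  by rewrite -(ler_pM2l c10) mulr0 (le_trans lo).
have psih (h : K) : psi (cell h) = 0.
  apply/eqP; rewrite -sqrf_eq0 eq_le sqr_ge0 andbT.
  apply: le_trans S0; rewrite (bigD1 h)//= add0r lerDl.
  by apply: sumr_ge0 => k _; exact: sqr_ge0.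
move=> n; have [h hE] := cell_rep p0 q0 n; rewrite (hE _ _ phip).
have [-> _] := split_phi (cell h); rewrite psih subr0; exact: php0.
Qed.

(** Nonnegativity of the solution of $(E-T)\phi=1$ improves itself: the neighbour sum is then
    nonnegative, so $1\le(E-V)\phi\le(E+d)\phi$, which is a strict lower bound. *)
Lemma positive_supersolution (c1 : R) : 0 < c1 ->
  (forall a : K -> R[i], c1 * (\sum_k nsq (a k)) <= gap_form 0 a) ->
  exists phi m P, [/\ 0 < m, forall n, m <= phi n, forall n, phi n <= P &
    forall n, nbr_sum phi n <= (E - V n) * phi n].
Proof.
move=> c10 pos.
(* The character of [k0] is constant for [s = t = 0], so the right-hand side represents the constant
   $-1$, the sign being that of $T-E$. *)
have [a aE] := floquet_solve (fun k : K => - (k == k0)%:R) c0 (below 0 0).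
pose phi n := complex.Re (bloch z1 z2 0 0 a n).
have phip : periodic2 p q phi.
  exact: periodic2_comp (periodic_bloch z1p z2q a).
have eqn n : (E - V n) * phi n - nbr_sum phi n = 1.
  have H : schrodinger V (bloch z1 z2 0 0 a) n - E%:C * bloch z1 z2 0 0 a n = -1.
    rewrite (schrodinger_bloch p0 q0 z1p z2q Vper) /bloch mulr_sumr -sumrB.
    rewrite (bigD1 k0)//= [X in _ + X]big1 ?addr0 => [|k /negPf kk0].
      rewrite mulrA -mulrBl aE eqxx /chi /= !expr0 !mulr1 cis0.
      by rewrite !exp1rz !mulr1.
    by rewrite mulrA -mulrBl aE kk0 oppr0 mul0r.
  have := congr1 (@complex.Re R) H.
  rewrite /schrodinger /laplacian /phi /nbr_sum.
  move: (bloch z1 z2 0 0 a) => f.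
  case: (f n) (f (n - (1, 0))) (f (n + (1, 0))) (f (n - (0, 1)))
    (f (n + (0, 1))) => [x1 y1] [x2 y2] [x3 y3] [x4 y4] [x5 y5] /=; lra.
have phi0 := negative_part_eq0 c10 pos phip eqn.
have nb0 n : 0 <= nbr_sum phi n by rewrite /nbr_sum !addr_ge0.
have ge1 n : 1 <= (E - V n) * phi n by rewrite -(eqn n) lerBlDr lerDl.
have EdL : E - V 0 <= E + d.
  by rewrite lerD2l; have := Vd 0; rewrite ler_norml => /andP[]; lra.
have EV n : (E - V n) * phi n <= (E + d) * phi n.
  rewrite ler_wpM2r// lerD2l.
  by have := Vd n; rewrite ler_norml => /andP[]; lra.
have Ed0 : 0 < E + d.
  have h := le_trans (ge1 0) (EV 0); rewrite ltNge; apply/negP => Ed.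
  have := mulr_le0_ge0 Ed (phi0 0); lra.
(* As [phi] is nonnegative and periodic, its sum over one cell is an upper bound. *)
exists phi, (E + d)^-1, (\sum_(h : K) phi (cell h)); split.
- by rewrite invr_gt0.
- move=> n; rewrite -[leLHS]mulr1 ler_pdivrMl//.
  exact: le_trans (ge1 n) (EV n).
- move=> n; have [h hE] := cell_rep p0 q0 n; rewrite (hE _ _ phip).
  by rewrite (bigD1 h)//= lerDl; apply: sumr_ge0.
- by move=> n; have := eqn n; lra.
Qed.

End UpperEdge.

(** * Spectral consequences at the edges and inside, and their combination *)

Lemma upper_edge (R : realType) (p q : nat) (p0 : (0 < p)%N) (q0 : (0 < q)%N) :
  exists2 e : R, 0 < e & forall (V : lattice -> R) (E E2 : R),
    periodic2 p q V -> (forall n, `|V n| <= e) -> 4 - e <= E ->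
    ~ spectrum (schrodinger V) E%:C -> E < E2 ->
    ~ spectrum (schrodinger V) E2%:C.
Proof.
have [z1 z1p] := prim_root_exists R p0; have [z2 z2q] := prim_root_exists R q0.
have [e e0 gap] := antiperiodic_symbol_gap p0 z1p z2q.
exists e => // V E E2 Vper Ve Ee ns EE2.
have [c c0 below] := floquet_bounded_below p0 q0 z1p z2q Vper Ve ns.
pose s0 : R := pi / p%:R.
have start (a : 'I_p * 'I_q -> R[i]) : 0 <= gap_form z1 z2 V E s0 a.
  have := @gap_form_bounds _ _ _ p0 q0 _ _ z1p z2q V e E Vper Ve s0 a e (`|E| + 4).
  have bnd (k : 'I_p * 'I_q) : e <= E - symbol z1 z2 s0 0 k <= `|E| + 4.
    apply/andP; split; first by have := gap k; rewrite -/s0; lra.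
    have := symbol_bound z1p z2q s0 0 k; rewrite ler_norml => /andP[h _].
    by have := ler_norm E; lra.
  by move=> /(_ bnd)/andP[]; rewrite subrr mul0r.
have [c1 c10 pos] := gap_form_positive p0 q0 z1p z2q Vper Ve c0 below start.
have [phi [m [P [m0 phim phiP super]]]] :=
  positive_supersolution p0 q0 z1p z2q Vper Ve c0 below c10 pos.
exact: (not_spectrum_above Ve m0 phim phiP super EE2).
Qed.

Lemma spectrum_reflection (R : realType) (V : lattice -> R) (M E : R) :
  (forall n, `|V n| <= M) ->
  spectrum (schrodinger V) E%:C -> spectrum (schrodinger (fun n => - V n)) (- E)%:C.
Proof.
move=> VM sE; apply: contrapT => ns.
have NVM n : `|- V n| <= M by rewrite normrN.
have [c c0 below] := bounded_below_spectrum NVM ns.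
have N1 : nsq (-1 : R[i]) = 1 by rewrite nsqN nsqC expr1n.
pose sg (n : lattice) : R[i] := (-1) ^ (n.1 + n.2).
have sg1 n : nsq (sg n) = 1 by exact: nsqXz.
have step n a : a.1 + a.2 = 1 \/ a.1 + a.2 = -1 -> sg (n + a) = - sg n.
  move=> ha; rewrite /sg /= addrACA expfzDr ?oppr_eq0 ?oner_eq0//.
  by case: ha => ->; rewrite ?expr1z ?exprN1 ?invrN1 mulrN1.
have below' v : l2 v -> c * sqnorm v <= sqnorm (shifted V E%:C v).
  move=> v2; pose u n := sg n * v n.
  have uE n : nsq (u n) = nsq (v n) by rewrite nsqM sg1 mul1r.
  have u2 : l2 u.
    by apply/l2P; have /l2P := v2; apply: eq_lsummable => n; rewrite uE.
  have := below u u2.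
  have -> : sqnorm u = sqnorm v by apply: eq_lsum => n; exact: uE.
  have -> // : sqnorm (shifted (fun n => - V n) (- E)%:C u) =
      sqnorm (shifted V E%:C v).
  apply: eq_lsum => n.
  have -> : shifted (fun n => - V n) (- E)%:C u n = - (sg n * shifted V E%:C v n).
    rewrite /shifted /schrodinger /laplacian /u.
    rewrite (step n (- (1, 0))); last by right.
    rewrite (step n (1, 0)); last by left.
    rewrite (step n (- (0, 1))); last by right.
    rewrite (step n (0, 1)); last by left.
    rewrite !rmorphN /=; move: (sg n) (v n) (v _) (v _) (v _) (v _) (V n).
    by move=> *; ring.
  by rewrite nsqN nsqM sg1 mul1r.
have EJ : (E%:C)^* = E%:C :> R[i] by exact: conjc_real.
by apply: (not_spectrum VM c0 below' _ sE); rewrite EJ.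
Qed.

(** A Bloch wave is not square summable, so it is no eigenvector in $\ell^2$; it places [E] in the
    spectrum by violating the lower bound that a resolvent would impose on the matrices. *)
Lemma bloch_eigen_spectrum (R : realType) (p q : nat) (p0 : (0 < p)%N)
    (q0 : (0 < q)%N) (z1 z2 : R[i]) (V : lattice -> R) (M E s t : R)
    (a : 'I_p * 'I_q -> R[i]) :
  p.-primitive_root z1 -> q.-primitive_root z2 -> periodic2 p q V ->
  (forall n, `|V n| <= M) -> 0 < \sum_k nsq (a k) ->
  (forall k, floquet z1 z2 V s t a k - E%:C * a k = 0) ->
  spectrum (schrodinger V) E%:C.
Proof.
move=> z1p z2q Vper VM a0 aE; apply: contrapT => ns.
have [c c0 /(_ s t a)] := floquet_bounded_below p0 q0 z1p z2q Vper VM ns.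
rewrite [leRHS]big1; last by move=> k _; rewrite aE /nsq /= expr0n addr0.
by rewrite leNgt mulr_gt0.
Qed.

Lemma interior_spectrum (R : realType) (p q : nat) (p0 : (0 < p)%N)
    (q0 : (0 < q)%N) (pq : coprime p q) (e : R) : 0 < e ->
  exists2 d : R, 0 < d & forall (V : lattice -> R) (E : R),
    periodic2 p q V -> (forall n, `|V n| <= d) -> -4 + e <= E <= 4 - e ->
    spectrum (schrodinger V) E%:C.
Proof.
have [z1 z1p] := prim_root_exists R p0; have [z2 z2q] := prim_root_exists R q0.
move=> e0.
pose P (d E : R) := forall V : lattice -> R, periodic2 p q V ->
  (forall n, `|V n| <= d) -> spectrum (schrodinger V) E%:C.
(* The threshold at [x] serves all energies near [x] and all smaller bounds on [V]; compactness of
   the segment extracts a common one. *)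
have cover : \forall d \near (0 : R)^'+, `[-4 + e, 4 - e] `<=` P d.
  have /compact_near_coveringP := @segment_compact R (-4 + e) (4 - e).
  apply=> x; rewrite /= in_itv /= => /andP[x1 x2].
  have [|d d0 Hd] := @floquet_eigen_near R p q p0 q0 pq z1 z2 z1p z2q x.
    by apply/andP; split; lra.
  exists ([set y | `|x - y| <= d], [set y | y <= d]) => /=.
    split; last exact: nbhs_right_le.
    by apply/nbhs_ballP; exists d => // y; rewrite /ball /= => /ltW.
  move=> [E f] /= [xE fd] V Vper Vf.
  have [s [t [a a0 aE]]] := Hd V E Vper xE (fun n => le_trans (Vf n) fd).
  exact: (bloch_eigen_spectrum p0 q0 z1p z2q Vper Vf a0 aE).
have [d [d0 dP]] := filter_ex (filterI (nbhs_right_gt (0 : R)) cover).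
by exists d => // V E Vper Vd E4; exact: (dP E).
Qed.

Theorem theorem6p1 (R : realType) (p q : nat)
    (hp : (2 <= p)%N) (hq : (2 <= q)%N) (hpq : coprime p q) :
  exists2 delta : R, 0 < delta &
    forall V : lattice -> R,
      pq_periodic p q V -> (supnorm V <= delta%:E)%E ->
      exists I : set R,
        [/\ I !=set0, is_interval I &
            spectrum (schrodinger V) = [set x%:C | x in I]].
Proof.
have p0 : (0 < p)%N by exact: leq_trans hp.
have q0 : (0 < q)%N by exact: leq_trans hq.
have [e1 e10 edge1] := upper_edge R p0 q0.
(* [e <= 4] puts 0 in the middle segment, which will show that the spectrum is nonempty. *)
have [e [e0 ee1 e4]] : exists e, [/\ 0 < e, e <= e1 & e <= 4].
  exists (Num.min e1 4); split; last 2 first.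
  - by rewrite ge_min lexx.
  - by rewrite ge_min lexx orbT.
  - by rewrite lt_min e10; lra.
have [d1 d10 inner] := interior_spectrum p0 q0 hpq e0.
exists (Num.min d1 e); first by rewrite lt_min d10 e0.
set d := Num.min _ _ => V Vpq Vsup.
have dd1 : d <= d1 by rewrite ge_min lexx.
have de : d <= e by rewrite ge_min lexx orbT.
have Vd n : `|V n| <= d.
  rewrite -lee_fin; apply: le_trans Vsup.
  by apply: ereal_sup_ubound; exists n.
have Vper : periodic2 p q V by move=> n1 n2; have [-> <-] := Vpq n1 n2.
have Nper : periodic2 p q (fun n => - V n) by exact: periodic2_comp (-%R) _ Vper.
have Nd n : `|- V n| <= e1 by rewrite normrN (le_trans (Vd n))// (le_trans de).
have Ve1 n : `|V n| <= e1 by rewrite (le_trans (Vd n))// (le_trans de).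
have mid E : -4 + e <= E <= 4 - e -> spectrum (schrodinger V) E%:C.
  by apply: inner => // n; rewrite (le_trans (Vd n)).
have top E E2 : 4 - e <= E -> E < E2 -> spectrum (schrodinger V) E2%:C ->
    spectrum (schrodinger V) E%:C.
  move=> Ee EE2 s2; apply: contrapT => ns.
  by apply: (edge1 V E E2 Vper Ve1 _ ns EE2 s2); lra.
have bot E E2 : E <= -4 + e -> E2 < E -> spectrum (schrodinger V) E2%:C ->
    spectrum (schrodinger V) E%:C.
  move=> Ee EE2 /(spectrum_reflection Vd) s2; apply: contrapT => ns.
  apply: (edge1 (fun n => - V n) (- E) (- E2) Nper Nd _ _ _ s2); [lra| |lra].
  move=> /(spectrum_reflection Nd); rewrite opprK => H; apply: ns.
  by move: H; congr (spectrum (schrodinger _) _); apply/funext => n; rewrite opprK.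
exists [set x | spectrum (schrodinger V) x%:C]; split.
- by exists 0; apply: mid; apply/andP; split; lra.
- move=> x y sx sy z /andP[xz zy].
  have [->//|xz'] := eqVneq z x; have [->//|zy'] := eqVneq z y.
  have {}xz : x < z by rewrite lt_neqAle eq_sym xz' xz.
  have {}zy : z < y by rewrite lt_neqAle zy' zy.
  (* Below the middle segment membership spreads upward from [x], above it downward from [y]. *)
  have [h1|h1] := leP z (-4 + e); first exact: bot h1 xz sx.
  have [h2|h2] := leP (4 - e) z; first exact: top h2 zy sy.
  by apply: mid; rewrite !ltW.
- apply/seteqP; split => [z sz|_ [x sx <-]//].
  have z0 := spectrum_real Vd sz; exists (complex.Re z); last first.
    by case: z z0 {sz} => a b /= ->.
  by case: z z0 sz => a b /= ->.
Qed.
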